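(* Let $L\in(0,\infty]$ and let $\|\cdot\|_{X(0,L)}$ be a rearrangement-invariant function norm on $(0,L)$. Let $u\colon(0,L)\to(0,\infty)$ be a nondegenerate nonincreasing function; if $L<\infty$, assume that $u(L^-)>0$. Let $v\colon(0,L)\to(0,\infty)$ be measurable. Let $\nu\colon(0,L)\to(0,L)$ be an increasing bijection. Set $$\varrho(f)=\Big\|v(t)\int_0^{\nu(t)}f^*(s)u(s)\,ds\Big\|_{X(0,L)},\quad f\in\mathfrak{M}^+(0,L),$$ and $$\xi(t)=\begin{cases}v(t)U(\nu(t)),\ t\in(0,L), &\text{if } L<\infty,\\ v(t)U(\nu(t))\chi_{(0,1)}(t)+v(t)\chi_{(1,\infty)}(t),\ t\in(0,\infty),&\text{if } L=\infty.\end{cases}$$ Then the functional $\varrho$ is a rearrangement-invariant function norm if and only if $\xi\in X(0,L)$. If $\xi\in X(0,L)$, then the rearrangement-invariant function space induced by $\varrho$ is the optimal domain space for the operator $R_{u,v,\nu}$ and $X(0,L)$. If $\xi\notin X(0,L)$, then there is no rearrangement-invariant function space $Z(0,L)$ such that $R_{u,v,\nu}\colon Z(0,L)\to X(0,L)$ is bounded.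
   Context: Conventions: $\frac1\infty=0\cdot\infty=0$. $\mathfrak{M}(0,L)$ is the set of (Lebesgue) measurable functions on $(0,L)$ with values in $[-\infty,\infty]$, and $\mathfrak{M}^+(0,L)$ is the subset of those that are nonnegative a.e. For $f\in\mathfrak M(0,L)$, $f^*(t)=\inf\{\lambda\in(0,\infty):|\{s\in(0,L):|f(s)|>\lambda\}|\le t\}$, $t\in(0,\infty)$, is its nonincreasing rearrangement. Functions $f,g$ are equimeasurable, $f\sim g$, if $|\{|f|>\lambda\}|=|\{|g|>\lambda\}|$ for every $\lambda\in(0,\infty)$. A rearrangement-invariant function norm on $(0,L)$ is a functional $\|\cdot\|_{X(0,L)}\colon\mathfrak{M}^+(0,L)\to[0,\infty]$ such that, for all $f,g,f_k\in\mathfrak M^+(0,L)$ and $\lambda\in[0,\infty)$: (P1) $\|f\|=0$ iff $f=0$ a.e., $\|\lambda f\|=\lambda\|f\|$, $\|f+g\|\le\|f\|+\|g\|$; (P2) $f\le g$ a.e. implies $\|f\|\le\|g\|$; (P3) $f_k\nearrow f$ a.e. implies $\|f_k\|\nearrow\|f\|$; (P4) $\|\chi_E\|<\infty$ for every measurable $E$ of finite measure; (P5) for every measurable $E$ of finite measure there is a finite constant $C_E>0$ with $\int_E f\le C_E\|f\|$ for all $f$; (P6) $\|f\|=\|g\|$ whenever $f\sim g$. It is extended to $\mathfrak M(0,L)$ by $\|f\|=\|\,|f|\,\|$, and $X(0,L)=\{f\in\mathfrak M(0,L):\|f\|_{X(0,L)}<\infty\}$ is the induced rearrangement-invariant function space.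 $X(0,L)\hookrightarrow Y(0,L)$ means that there is $C>0$ with $\|f\|_{Y(0,L)}\le C\|f\|_{X(0,L)}$ for all $f\in\mathfrak M(0,L)$. $U(t)=\int_0^tu(s)\,ds$; $u$ is nondegenerate if $0<U(t_0)<\infty$ for some $t_0\in(0,L)$. $u(L^-)$ is the left limit at $L$. The operator is $R_{u,v,\nu}g(t)=v(t)\int_0^{\nu(t)}|g(s)|u(s)\,ds$, $t\in(0,L)$, $g\in\mathfrak M(0,L)$. An operator $T$ is bounded from $X(0,L)$ to $Y(0,L)$ if $\|Tf\|_{Y(0,L)}\le C\|f\|_{X(0,L)}$ for some $C$ and all $f$. A rearrangement-invariant function space $W(0,L)$ is the optimal domain space for $T$ and $X(0,L)$ if $T\colon W(0,L)\to X(0,L)$ is bounded and $Z(0,L)\hookrightarrow W(0,L)$ whenever $Z(0,L)$ is a rearrangement-invariant function space such that $T\colon Z(0,L)\to X(0,L)$ is bounded. *)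

(* Defs.v *)
From HB Require Import structures.
From mathcomp Require Import all_boot all_order all_algebra.
From mathcomp Require Import all_classical all_reals all_analysis measurable_realfun.

Set Implicit Arguments.
Unset Strict Implicit.
Unset Printing Implicit Defensive.

Import Order.TTheory GRing.Theory Num.Theory.
Import numFieldNormedType.Exports.

Local Open Scope classical_set_scope.
Local Open Scope ring_scope.
Local Open Scope ereal_scope.

(* [R] with the sigma-algebra of Lebesgue measurable sets, i.e. the
   Caratheodory sigma-algebra carrying [completed_lebesgue_measure]; the
   canonical measurable structure of [R] itself is the Borel one. *)
Notation LebR R := (caratheodory_type (@wlength R idfun)^*%mu).

(* Functions on (0, L) are represented by functions on [R], whose values
   outside [itv0 L] are irrelevant; function norms are represented by
   functionals on [R -> \bar R], constrained only on [Mplus L].  The induced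
   function space is identified with its function norm. *)
Section function_norms.
Variables (R : realType) (L : \bar R).
Implicit Types (f g : R -> \bar R) (E : set R).
Implicit Types (rho X Y Z W : (R -> \bar R) -> \bar R).

Local Notation mu := (@completed_lebesgue_measure R).

Definition itv0 : set R := [set t | 0 < t%:E /\ t%:E < L].

Definition Mfun f : Prop :=
  measurable_fun (itv0 : set (LebR R)) (f : LebR R -> \bar R).

Definition ae0 (P : R -> Prop) : Prop := {ae mu, forall t, itv0 t -> P t}.

Definition Mplus f : Prop := Mfun f /\ ae0 (fun t => 0 <= f t).

Definition distribution_fun f (l : R) : \bar R :=
  mu [set s | itv0 s /\ l%:E < `|f s|].

Definition rearrangement f (t : R) : \bar R :=
  ereal_inf [set l%:E | l in [set l : R | (0 < l)%R /\
                                        distribution_fun f l <= t%:E]].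

Definition equimeasurable f g : Prop :=
  forall l : R, (0 < l)%R -> distribution_fun f l = distribution_fun g l.

Definition finite_measure_subset E : Prop :=
  [/\ measurable (E : set (LebR R)), E `<=` itv0 & mu E < +oo].

Record ri_norm rho : Prop := RiNorm {
  ri_norm_ge0 : forall f, Mplus f -> 0 <= rho f ;
  ri_norm_eq0 : forall f, Mplus f -> rho f = 0 <-> ae0 (fun t => f t = 0) ;
  ri_normZ : forall (a : R) f, (0 <= a)%R -> Mplus f ->
    rho (fun t => a%:E * f t) = a%:E * rho f ;
  ri_normD : forall f g, Mplus f -> Mplus g ->
    rho (fun t => f t + g t) <= rho f + rho g ;
  ri_norm_le : forall f g, Mplus f -> Mplus g ->
    ae0 (fun t => f t <= g t) -> rho f <= rho g ;
  ri_norm_cvg : forall (f_ : nat -> R -> \bar R) f,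
    (forall k, Mplus (f_ k)) -> Mplus f ->
    ae0 (fun t => nondecreasing_seq (f_ ^~ t) /\
                  f_ k t @[k --> \oo] --> f t) ->
    nondecreasing_seq (fun k => rho (f_ k)) /\
    rho (f_ k) @[k --> \oo] --> rho f ;
  ri_norm_indic : forall E, finite_measure_subset E ->
    rho (fun t => (\1_E t)%:E) < +oo ;
  ri_norm_integral : forall E, finite_measure_subset E ->
    exists2 C : R, (0 < C)%R & forall f, Mplus f ->
      \int[mu]_(t in E) f t <= C%:E * rho f ;
  ri_norm_equim : forall f g, Mplus f -> Mplus g ->
    equimeasurable f g -> rho f = rho g }.

Definition abs_norm rho f : \bar R := rho (fun t => `|f t|).

Definition ri_space rho : set (R -> \bar R) :=
  [set f | Mfun f /\ abs_norm rho f < +oo].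

Definition embedded X Y : Prop :=
  exists2 C : R, (0 < C)%R &
    forall f, Mfun f -> abs_norm Y f <= C%:E * abs_norm X f.

Definition bounded_operator (T : (R -> \bar R) -> R -> \bar R) X Y : Prop :=
  exists C : R, forall f, Mfun f -> abs_norm Y (T f) <= C%:E * abs_norm X f.

Definition optimal_domain (T : (R -> \bar R) -> R -> \bar R) X W : Prop :=
  [/\ ri_norm W,
      bounded_operator T W X &
      forall Z, ri_norm Z -> bounded_operator T Z X -> embedded Z W].

End function_norms.

Section operator.
Variable R : realType.
Implicit Types (L : \bar R) (u v nu : R -> R).

Local Notation mu := (@completed_lebesgue_measure R).

Definition weight_primitive u (t : R) : \bar R :=
  \int[mu]_(s in `]0%R, t[) (u s)%:E.

Definition nondegenerate_weight L u : Prop :=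
  exists2 t0, itv0 L t0 & 0 < weight_primitive u t0 < +oo.

Definition Rop u v nu (g : R -> \bar R) (t : R) : \bar R :=
  (v t)%:E * \int[mu]_(s in `]0%R, nu t[) (`|g s| * (u s)%:E).

Definition varrho L (X : (R -> \bar R) -> \bar R) u v nu (f : R -> \bar R) :
    \bar R :=
  X (fun t => (v t)%:E *
       \int[mu]_(s in `]0%R, nu t[) (rearrangement L f s * (u s)%:E)).

Definition xi L u v nu (t : R) : \bar R :=
  if L < +oo then (v t)%:E * weight_primitive u (nu t)
  else (v t)%:E * weight_primitive u (nu t) * (\1_(`]0%R, 1%R[%classic) t)%:E +
       (v t)%:E * (\1_(`]1%R, +oo[%classic) t)%:E.

End operator.

(* Main.v *)
(** The functional [varrho f] is the norm in [X] of the weighted Hardy operator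
    applied to the rearrangement [f*] of [f].  Everything rests on the formula
    [int_S f* = min_c (c |S| + int (|f| - c)_+)] for initial intervals [S] of
    [(0, L)]: the excess [(|f| - c)_+] has the same integral for [f] and [f*]
    (layer cake), it is subadditive, and [c = f*(|S|)] attains the minimum.  It
    yields both [int_S |f| <= int_S f*] and [int_S (f+g)* <= int_S f* + int_S g*];
    since the superlevel sets of the nonincreasing weight [u] are initial
    intervals, another layer-cake argument puts [u] under the integrals.
    The first inequality bounds the operator by [varrho], the second is the
    triangle inequality.  Optimality follows by testing the operator on [f*],
    and [xi] is comparable to the image of a suitable indicator function. *)
Require Import Defs.
From HB Require Import structures.
From mathcomp Require Import all_boot all_order all_algebra.
From mathcomp Require Import all_classical all_reals all_analysis measurable_realfun.

Set Implicit Arguments.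
Unset Strict Implicit.
Unset Printing Implicit Defensive.

Import Order.TTheory GRing.Theory Num.Theory.
Import numFieldNormedType.Exports.

Local Open Scope classical_set_scope.
Local Open Scope ring_scope.

(** * Layer cake formula and comparison of weighted integrals *)

Section layer_cake.
Local Open Scope ereal_scope.
Context d (T : measurableType d) (R : realType).
Variable m : {sigma_finite_measure set T -> \bar R}.
Implicit Types (D : set T) (F G w : T -> \bar R).

(** The minimum is attained at a real [c] only, so the case of an infinite integral of [f*] is split
    off each time. The intervals [S] that matter have finite measure, because [u] is always
    integrated over some []0, t[]. Most facts on [f*] rest on one exchange: for real [l >= 0],
    [l < f*(s)] if and only if [s] is less than the measure of the set where [|f| > l]. (P5) for
    [varrho] compares [f] on an arbitrary [E] with [f*] near 0. The norm of [X] is tested on an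
    interval []t0, t1[] away from 0, with [v] cut at 1 because [v] may have infinite norm even
    there. Definiteness of [varrho] is drawn from (P5). The two forms of [xi] come from the bounded
    support of the rearrangement of an indicator of a set of finite measure: its weighted integral
    over []0, nu t[] stays bounded in [t], whereas [U (nu t)] may tend to infinity when [L = +oo].
    Hence only [v] remains beyond 1. At the point 1 itself [xi] vanishes, so the upper bound by [xi]
    holds almost everywhere only. *)

Let sublevel w : set (T * measurableTypeR R) :=
  [set p | (0 < p.2)%R /\ p.2%:E < w p.1].

Let measurable_sublevel w : measurable_fun setT w -> measurable (sublevel w).
Proof.
move=> mw.
have -> : sublevel w = (setT `&` [set p : T * measurableTypeR R | (cst 0 p : \bar R) < p.2%:E])
    `&` (setT `&` [set p | p.2%:E < w p.1]).
  rewrite !setTI; apply/seteqP; split => p /=; rewrite /sublevel /= ?lte_fin; tauto.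
have m2 : measurable_fun setT (fun p : T * measurableTypeR R => p.2%:E).
  by apply/measurable_EFinP; exact: measurable_snd.
apply: measurableI.
- exact: measurable_lte.
- by apply: measurable_lte => //; apply: measurableT_comp => //; exact: measurable_fst.
Qed.

(** The integrand for Tonelli: integrating out the level gives [F * w], integrating out the point
    gives the integrals of [F] over the superlevel sets of [w]. Levels carry the Borel structure and
    [lebesgue_measure]; the points carry any sigma-finite [m], later the completed measure. *)
Let kern F w (p : T * measurableTypeR R) := F p.1 * (\1_(sublevel w) p)%:E.

Let measurable_kern F w : measurable_fun setT F -> measurable_fun setT w ->
  measurable_fun setT (kern F w).
Proof.
move=> mF mw; apply: emeasurable_funM.
  by apply: measurableT_comp => //; exact: measurable_fst.
by apply/measurable_EFinP; apply: measurable_indic; exact: measurable_sublevel.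
Qed.

Let kern_int1 F w y : (0 < y)%R ->
  \int[m]_x kern F w (x, y) = \int[m]_(x in [set x | y%:E < w x]) F x.
Proof.
move=> y0; rewrite [RHS]integral_mkcond; apply: eq_integral => x _.
rewrite /kern patchE /= indicE; case: ifPn => h.
  by rewrite mem_set ?mule1 //; split => //; exact: set_mem h.
by rewrite memNset ?mule0 // => -[_ h']; move/negP: h; apply; exact: mem_set.
Qed.

Let kern_restrict D F w y : (0 < y)%R ->
  \int[m]_x kern (F \_ D) (w \_ D) (x, y) =
  \int[m]_(x in D `&` [set x | y%:E < w x]) F x.
Proof.
move=> y0; rewrite kern_int1 // integral_mkcond [RHS]integral_mkcond.
apply: eq_integral => x _; rewrite !patchE in_setI /=.
case: (boolP (x \in D)) => xD /=; last by case: ifPn.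
by congr (if _ then _ else _); apply/idP/idP; rewrite !inE /= patchE xD.
Qed.

Let kern_int2 F w x : 0 <= w x -> 0 <= F x ->
  \int[lebesgue_measure]_y kern F w (x, y) = F x * w x.
Proof.
move=> w0 F0; rewrite /kern /=.
pose A : set R := [set y | (0 < y)%R /\ y%:E < w x].
(* The levels below the graph at [x] form an interval that is unbounded exactly when [w x = +oo], so
   its length is [w x] in every case. *)
have AE : A = [set` Interval (BRight 0%R) (if w x is r%:E then BLeft r else +oo%O)].
  rewrite /A; apply/seteqP; case: (w x) w0 => [r| |] //= w0; split => y /=;
    rewrite ?in_itv /= ?lte_fin ?ltry ?andbT.
  + by move=> [-> ->].
  + by move=> /andP.
  + by move=> [].
  + by [].
have mA : measurable A by rewrite AE; exact: measurable_itv.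
have muA : lebesgue_measure A = w x.
  rewrite AE lebesgue_measure_itv /=.
  case: (w x) w0 => [r| |] //= r0; rewrite ?ltry ?lte_fin ?oppr0 ?adde0 ?oppe0 //.
  by case: ltP => // h; congr (_%:E); apply/eqP; rewrite eq_le h -lee_fin r0.
transitivity (\int[lebesgue_measure]_y (F x * (\1_A y)%:E)).
  by apply: eq_integral => y _; rewrite !indicE.
rewrite ge0_integralZl //.
- by rewrite integral_indic // setIT; congr (_ * _); exact: muA.
- by apply/measurable_EFinP; exact: measurable_indic.
Qed.

(** Tonelli for [kern], after [F] and [w] are extended by zero outside [D]. *)
Lemma integral_layer_cake D F w : measurable D ->
  measurable_fun D F -> measurable_fun D w ->
  (forall x, D x -> 0 <= F x) -> (forall x, D x -> 0 <= w x) ->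
  \int[m]_(x in D) (F x * w x) =
  \int[lebesgue_measure]_(y in `]0%R, +oo[)
    \int[m]_(x in D `&` [set x | y%:E < w x]) F x.
Proof.
move=> mD /(measurable_restrictT _ mD) mF /(measurable_restrictT _ mD) mw F0 w0.
have F0' x : 0 <= (F \_ D) x by apply: erestrict_ge0.
have w0' x : 0 <= (w \_ D) x by apply: erestrict_ge0.
transitivity (\int[m]_x \int[lebesgue_measure]_y kern (F \_ D) (w \_ D) (x, y)).
  rewrite integral_mkcond; apply: eq_integral => x _.
  by rewrite kern_int2 // !patchE; case: ifPn => // _; rewrite mule0.
rewrite fubini_tonelli /=; last 2 first.
- exact: measurable_kern.
- by move=> p; rewrite /kern mule_ge0 // lee_fin.
rewrite [RHS]integral_mkcond; apply: eq_integral => y _.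
rewrite patchE; case: ifPn => [|/negP y0].
  rewrite inE /= in_itv /= andbT => y0.
  by rewrite kern_restrict.
rewrite integral0_eq // => x _; rewrite /kern indicE memNset ?mule0 // => -[/= y0' _].
by apply: y0; rewrite inE /= in_itv /= y0'.
Qed.

Lemma measurable_integral_superlevel D F w : measurable D ->
  measurable_fun D F -> measurable_fun D w -> (forall x, D x -> 0 <= F x) ->
  measurable_fun (`]0%R, +oo[%classic : set (measurableTypeR R))
    (fun y => \int[m]_(x in D `&` [set x | y%:E < w x]) F x).
Proof.
move=> mD /(measurable_restrictT _ mD) mF /(measurable_restrictT _ mD) mw F0.
have F0' x : 0 <= (F \_ D) x by apply: erestrict_ge0.
apply: (eq_measurable_fun (fun y => \int[m]_x kern (F \_ D) (w \_ D) (x, y))).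
  move=> y; rewrite inE /= in_itv /= andbT => y0.
  by rewrite kern_restrict.
apply: measurable_funTS.
apply: (measurable_fun_fubini_tonelli_G (m1 := m)).
- exact: measurable_kern.
- by move=> p; rewrite /kern mule_ge0 // lee_fin.
Qed.

(** After the layer cake formula on both sides, the hypothesis is the inequality between the
    integrands at each level [y]. *)
Lemma le_integral_weight D F G w : measurable D ->
  measurable_fun D F -> measurable_fun D G -> measurable_fun D w ->
  (forall x, D x -> 0 <= F x) -> (forall x, D x -> 0 <= G x) ->
  (forall x, D x -> 0 <= w x) ->
  (forall y, (0 < y)%R ->
    \int[m]_(x in D `&` [set x | y%:E < w x]) F x <=
    \int[m]_(x in D `&` [set x | y%:E < w x]) G x) ->
  \int[m]_(x in D) (F x * w x) <= \int[m]_(x in D) (G x * w x).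
Proof.
move=> mD mF mG mw F0 G0 w0 FG; rewrite !integral_layer_cake //.
apply: ge0_le_integral => //.
- by move=> y _; apply: integral_ge0 => x [/F0].
- exact: measurable_integral_superlevel.
- exact: measurable_integral_superlevel.
- by move=> y /=; rewrite in_itv /= andbT; exact: FG.
Qed.

End layer_cake.

(** * Distribution function and nonincreasing rearrangement *)

Section rearrangement.
Local Open Scope ereal_scope.
Context (R : realType).
Local Notation mu := (@completed_lebesgue_measure R).

(** If [y < x], then [y] is a nonnegative real and is itself a level that refutes the hypothesis.
    This form suits rearrangements, which are known through strict comparison with real levels. *)
Lemma lte_ge0_imp_le (x y : \bar R) : 0 <= y ->
  (forall l : R, (0 <= l)%R -> l%:E < x -> l%:E < y) -> x <= y.
Proof.
move=> y0 xy; rewrite leNgt; apply/negP => yx.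
have yfin : y \is a fin_num.
  by rewrite ge0_fin_numE // (lt_le_trans yx) // leey.
move: (xy (fine y)); rewrite fineK // ltxx => /(_ _ yx) h.
by have : false by apply: h; rewrite fine_ge0.
Qed.

Lemma measurable_LebR_itv (i : interval R) :
  measurable ([set` i] : set (LebR R)).
Proof. by apply: sub_caratheodory; exact: measurable_itv. Qed.

Lemma measurable_LebR_interval (A : set R) : is_interval A ->
  measurable (A : set (LebR R)).
Proof. by move=> /is_intervalP ->; exact: measurable_LebR_itv. Qed.

Lemma itv0_interval (x : \bar R) : is_interval (itv0 x).
Proof.
move=> a b [a0 ax] [b0 bx] z /andP[az zb]; split.
  by rewrite (lt_le_trans a0) // lee_fin.
by rewrite (le_lt_trans _ bx) // lee_fin.
Qed.

Lemma measurable_itv0 (x : \bar R) : measurable (itv0 x : set (LebR R)).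
Proof. by apply: measurable_LebR_interval; exact: itv0_interval. Qed.

Lemma itv0_EFin (x : R) : itv0 x%:E = `]0%R, x[%classic.
Proof.
by apply/seteqP; split => y; rewrite /itv0 /= in_itv /= !lte_fin;
  [move=> [-> ->]|move=> /andP].
Qed.

Lemma itv0_pinfty : itv0 (+oo : \bar R) = `]0%R, +oo[%classic.
Proof.
by apply/seteqP; split => y; rewrite /itv0 /= in_itv /= !lte_fin ltry andbT => // -[].
Qed.

Lemma measure_itv0 (x : \bar R) : 0 <= x -> mu (itv0 x) = x.
Proof.
(* The completed measure and [lebesgue_measure] agree by conversion, so the length formula for
   intervals applies. *)
have E (A : set R) : mu A = lebesgue_measure A by [].
rewrite E; case: x => [r| |] // r0.
  rewrite itv0_EFin lebesgue_measure_itv /= lte_fin oppr0 adde0.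
  by case: ltP => // h; congr (_%:E); apply/eqP; rewrite eq_le h -lee_fin r0.
by rewrite itv0_pinfty lebesgue_measure_itv /= ltry.
Qed.

Lemma subset_itv0 (x y : \bar R) : x <= y -> itv0 x `<=` itv0 y.
Proof. by move=> xy t [t0 tx]; split => //; exact: lt_le_trans xy. Qed.

Context (L : \bar R).
Implicit Types (f g h : R -> \bar R) (s t l : R).

Lemma MfunW f (S : set R) : S `<=` itv0 L -> Mfun L f ->
  measurable_fun (S : set (LebR R)) (f : LebR R -> \bar R).
Proof. by move=> SI; apply: measurable_funS => //; exact: measurable_itv0. Qed.

(** The preimages of upward rays under a monotone function on an interval are intervals. The flag
    [b] is true for nondecreasing and false for nonincreasing functions. *)
Lemma Mfun_mono f (b : bool) :
  (forall s t, itv0 L s -> itv0 L t -> (s <= t)%R ->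
     if b then f s <= f t else f t <= f s) -> Mfun L f.
Proof.
move=> f_mono; apply: (measurability _ (ErealGenOInfty.measurableE R)).
move=> /= _ [_ [r ->] <-].
apply: measurable_LebR_interval => a c [[a0 aL] fa] [[c0 cL] fc] z /andP[az zc].
have zI : itv0 L z.
  by apply: (@itv0_interval L a c) => //; rewrite az zc.
split => //; move: fa fc; rewrite /= !in_itv /= !andbT => fa fc.
case: b f_mono => f_mono.
- by apply: (lt_le_trans fa); apply: f_mono.
- by apply: (lt_le_trans fc); apply: f_mono.
Qed.

Lemma Mfun_abs f : Mfun L f -> Mfun L (fun t => `|f t|).
Proof. by move=> mf; exact: measurableT_comp. Qed.

Lemma MplusI f : Mfun L f -> (forall t, itv0 L t -> 0 <= f t) -> Mplus L f.
Proof. by move=> mf f0; split => //; exact: aeW. Qed.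

Definition superlevel f l : set R := [set s | itv0 L s /\ l%:E < `|f s|].

Lemma measurable_superlevel f l : Mfun L f ->
  measurable (superlevel f l : set (LebR R)).
Proof.
move=> /Mfun_abs mf.
exact: (emeasurable_fun_o_infty (measurable_itv0 L) mf).
Qed.

Lemma distribution_fun_le f l l' : Mfun L f -> (l <= l')%R ->
  distribution_fun L f l' <= distribution_fun L f l.
Proof.
move=> mf ll'; apply: le_measure; rewrite ?inE; try exact: measurable_superlevel.
by move=> s [sI h]; split => //; apply: le_lt_trans h; rewrite lee_fin.
Qed.

Lemma rearrangement_ge0 f s : 0 <= rearrangement L f s.
Proof. by apply: le_ereal_inf_tmp => _ [l [l0 _] <-]; rewrite lee_fin ltW. Qed.

Lemma rearrangement_le f s t : (s <= t)%R -> rearrangement L f t <= rearrangement L f s.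
Proof.
move=> st; apply: ereal_inf_le_tmp => _ [l [l0 h] <-]; exists l => //; split => //.
by apply: (le_trans h); rewrite lee_fin.
Qed.

Lemma le_rearrangement f g s : (forall l, (0 < l)%R ->
    distribution_fun L f l <= distribution_fun L g l) ->
  rearrangement L f s <= rearrangement L g s.
Proof.
move=> fg; apply: ereal_inf_le_tmp => _ [l [l0 h] <-]; exists l => //; split => //.
by rewrite (le_trans _ h) // fg.
Qed.

Lemma equimeasurable_rearrangement f g : equimeasurable L f g ->
  rearrangement L f = rearrangement L g.
Proof.
move=> fg; apply/funext => s; apply/eqP; rewrite eq_le.
by apply/andP; split; apply: le_rearrangement => l /fg ->.
Qed.

Lemma rearrangement_abs f : rearrangement L (fun t => `|f t|) = rearrangement L f.
Proof.
apply: equimeasurable_rearrangement => l _; rewrite /distribution_fun.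
by congr (mu _); apply/seteqP; split => s /=; rewrite abse_id.
Qed.

(* By right continuity of the distribution function, [s < distribution_fun L f l]
   persists for some [l + 1/(n+1)] in place of [l]. *)
Lemma lt_rearrangement f s l : Mfun L f -> (0 <= l)%R ->
  (l%:E < rearrangement L f s) = (s%:E < distribution_fun L f l).
Proof.
move=> mf l0; apply/idP/idP; apply: contraLR; rewrite -!leNgt => h.
  apply/lee_addgt0Pr => e e0; apply: ereal_inf_lbound; exists (l + e)%R => //.
  split; first by rewrite ltr_wpDl.
  by apply: le_trans h; apply: distribution_fun_le => //; rewrite lerDl ltW.
rewrite /distribution_fun -/(superlevel f l).
pose A n := superlevel f (l + n.+1%:R^-1).
have A_nd : nondecreasing_seq A.
  move=> n m nm; apply/subsetPset => x [xI hx]; split => //.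
  by apply: le_lt_trans hx; rewrite lee_fin lerD2l lef_pV2 ?posrE // ler_nat.
have AU : superlevel f l = \bigcup_n A n.
  apply/seteqP; split => x.
    move=> [xI lx].
    have [n nx] : exists n : nat, (l + n.+1%:R^-1)%:E < `|f x|.
      case E : (`|f x|) lx => [r| |] // lx; last by exists 0%N; rewrite ltry.
      rewrite lte_fin in lx; have rl : (0 < r - l)%R by rewrite subr_gt0.
      have [n nr] := ltr_add_invr lx.
      by exists n; rewrite lte_fin.
    by exists n => //; split.
  move=> [n _ [xI hx]]; split => //; apply: lt_trans hx.
  by rewrite lte_fin ltrDl.
rewrite AU; have cvg := @nondecreasing_cvg_mu _ _ _ mu A
  (fun n => measurable_superlevel _ mf)
  (bigcup_measurable (fun n _ => measurable_superlevel _ mf)) A_nd.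
rewrite -(cvg_lim _ cvg) //; apply: lime_le; first by apply/cvg_ex; eexists; exact: cvg.
apply: nearW => n /=; rewrite leNgt; apply/negP => hn.
have : (l + n.+1%:R^-1)%:E <= rearrangement L f s.
  apply: le_ereal_inf_tmp => _ [l' [l'0 h'] <-]; rewrite lee_fin leNgt.
  apply/negP => h''; have := le_lt_trans h' hn; rewrite ltNge.
  by move/negP; apply; apply: distribution_fun_le => //; exact: ltW.
move=> /le_trans /(_ h); rewrite lee_fin gerDl leNgt => /negP; apply.
by rewrite invr_gt0.
Qed.

Lemma Mfun_rearrangement f : Mfun L (rearrangement L f).
Proof. by apply: (@Mfun_mono _ false) => s t _ _; exact: rearrangement_le. Qed.

(** By [lt_rearrangement] the superlevel set of the rearrangement is the interval from 0 to
    [distribution_fun L f l]. That number is at most [L], so the interval lies in [itv0 L] and has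
    this number as its measure. *)
Lemma distribution_rearrangement f l : Mfun L f -> 0 <= L -> (0 <= l)%R ->
  distribution_fun L (rearrangement L f) l = distribution_fun L f l.
Proof.
move=> mf L0 l0.
have DL : distribution_fun L f l <= L.
  rewrite -[leRHS]measure_itv0 //; apply: le_measure; rewrite ?inE.
  - exact: measurable_superlevel.
  - exact: measurable_itv0.
  - by move=> s [].
rewrite -[RHS]measure_itv0 ?measure_ge0 //; congr (mu _).
apply/seteqP; split => s.
  by move=> [[s0 sL]]; rewrite gee0_abs ?rearrangement_ge0 // lt_rearrangement.
move=> [s0 sD]; split; first by split => //; exact: lt_le_trans DL.
by rewrite gee0_abs ?rearrangement_ge0 // lt_rearrangement.
Qed.

Lemma equimeasurable_rearrangementl f : Mfun L f -> 0 <= L ->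
  equimeasurable L (rearrangement L f) f.
Proof. by move=> mf L0 l l0; rewrite distribution_rearrangement // ltW. Qed.

End rearrangement.

(** * Initial intervals and the minimum formula for integrals of rearrangements *)

Section lower_sets.
Local Open Scope ereal_scope.
Context (R : realType).
Local Notation mu := (@completed_lebesgue_measure R).
Context (L : \bar R).
Hypothesis L_ge0 : 0 <= L.
Implicit Types (f g h : R -> \bar R) (s t l c : R) (S E : set R).

(** An initial interval of [(0, L)] with its right end left open or closed, possibly empty or
    everything. Superlevel sets of a nonincreasing function have this form whatever happens at the
    end point. *)
Definition lower_set S := S `<=` itv0 L /\
  forall s t, S t -> (0 < s)%R -> (s <= t)%R -> S s.

Lemma measurable_lower_set S : lower_set S -> measurable (S : set (LebR R)).
Proof.
move=> [SI lowS]; apply: measurable_LebR_interval => s t Ss St z /andP[sz zt].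
apply: (lowS _ t) => //; have [s0 _] := SI _ Ss.
by rewrite lte_fin in s0; exact: lt_le_trans sz.
Qed.

(** With [lower_set_le], this identifies [mu S] as the right end of [S]: a member [t] forces []0,
    t[] into [S], a nonmember confines [S] to its left. *)
Lemma lower_set_ge S t : lower_set S -> S t -> t%:E <= mu S.
Proof.
move=> lS St; have [t0 _] := lS.1 _ St.
rewrite -[leLHS](measure_itv0 (ltW t0)); apply: le_measure; rewrite ?inE.
- exact: measurable_itv0.
- exact: measurable_lower_set.
- by move=> s [s0 st]; apply: (lS.2 _ t) => //; rewrite ltW.
Qed.

Lemma lower_set_le S t : lower_set S -> (0 < t)%R -> ~ S t -> mu S <= t%:E.
Proof.
move=> lS t0 St; have t0' : 0 <= t%:E by rewrite lee_fin ltW.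
rewrite -[leRHS](measure_itv0 t0'); apply: le_measure; rewrite ?inE.
- exact: measurable_lower_set.
- exact: measurable_itv0.
- move=> s Ss; split; first by have [] := lS.1 _ Ss.
  by rewrite lte_fin ltNge; apply/negP => ts; apply: St; exact: (lS.2 _ s).
Qed.

Lemma lower_set_gt0 S : lower_set S -> S = set0 \/ 0 < mu S.
Proof.
move=> lS; have [->|/set0P[t St]] := eqVneq S set0; [by left|right].
by apply: lt_le_trans (lower_set_ge lS St); have [] := lS.1 _ St.
Qed.

(** The level [c] is real, so the difference makes sense also where [h] is infinite. *)
Definition excess h c s := maxe (`|h s| - c%:E) 0.

Lemma excess_ge0 h c s : 0 <= excess h c s.
Proof. by rewrite le_max lexx orbT. Qed.

Lemma Mfun_excess h c : Mfun L h -> Mfun L (excess h c).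
Proof.
move=> mh; apply: measurable_maxe; last exact: measurable_cst.
by apply: emeasurable_funB; [exact: Mfun_abs|exact: measurable_cst].
Qed.

(** Layer cake with integrand 1 and weight [excess h c], whose superlevel set at [y > 0] is that of
    [h] at [y + c]. The integral therefore depends on the distribution function alone. *)
Lemma integral_excess h c : Mfun L h -> (0 <= c)%R ->
  \int[mu]_(s in itv0 L) excess h c s =
  \int[lebesgue_measure]_(y in `]0%R, +oo[) distribution_fun L h (y + c)%R.
Proof.
move=> mh c0; have mI := @measurable_itv0 R L.
under eq_integral do rewrite -[excess _ _ _]mul1e.
rewrite (@integral_layer_cake _ _ _ mu _ (cst 1)) //; first last.
- by move=> s _; exact: excess_ge0.
- exact: Mfun_excess.
apply: eq_integral => y; rewrite inE /= in_itv /= andbT => y0.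
have -> : itv0 L `&` [set s | y%:E < excess h c s] = superlevel L h (y + c).
  have E s : (y%:E < excess h c s) = ((y + c)%:E < `|h s|).
    have yN : (y%:E < 0) = false by rewrite lte_fin ltNge ltW.
    by rewrite lt_max yN orbF lteBrDr.
  by apply/seteqP; split => s [sI /=]; rewrite E.
rewrite (@integral_cst _ _ _ mu) ?mul1e //.
exact: measurable_superlevel.
Qed.

Lemma integral_excess_rearrangement h c : Mfun L h -> (0 <= c)%R ->
  \int[mu]_(s in itv0 L) excess (rearrangement L h) c s =
  \int[mu]_(s in itv0 L) excess h c s.
Proof.
move=> mh c0; rewrite !integral_excess //; last exact: Mfun_rearrangement.
apply: eq_integral => y; rewrite inE /= in_itv /= andbT => y0.
by rewrite distribution_rearrangement // addr_ge0 // ltW.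
Qed.

Lemma integral_le_excess h c E : Mfun L h -> (0 <= c)%R -> E `<=` itv0 L ->
  measurable (E : set (LebR R)) ->
  \int[mu]_(s in E) `|h s| <= c%:E * mu E + \int[mu]_(s in itv0 L) excess h c s.
Proof.
move=> mh c0 EI mE; have mEh := MfunW EI (Mfun_abs mh).
have mex := MfunW EI (Mfun_excess c mh).
apply: (@le_trans _ _ (\int[mu]_(s in E) (c%:E + excess h c s))).
  apply: (@ge0_le_integral _ _ _ mu _ mE _ _ _ mEh).
  - by move=> s _; exact: abse_ge0.
  - by apply: emeasurable_funD => //; exact: measurable_cst.
  - by move=> s _; rewrite -leeBlDl // le_max lexx.
rewrite ge0_integralD //; last by move=> s _; exact: excess_ge0.
rewrite (@integral_cst _ _ _ mu) // leeD2l //.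
apply: ge0_subset_integral => //; [exact: measurable_itv0|exact: Mfun_excess|].
by move=> s _; exact: excess_ge0.
Qed.

(** With [c = h*(b)], monotonicity gives [h* >= c] on [S] and [h* <= c] off [S]. The excess of [h*]
    thus vanishes off [S] and equals [h* - c] on [S], so the terms in [c] cancel. *)
Lemma excess_le_integral h S b : Mfun L h -> lower_set S -> mu S = b%:E ->
  (0 < b)%R -> \int[mu]_(s in S) rearrangement L h s < +oo ->
  exists2 c, (0 <= c)%R & c%:E * b%:E + \int[mu]_(s in itv0 L) excess h c s <=
     \int[mu]_(s in S) rearrangement L h s.
Proof.
move=> mh lS muS b0 fin; have mS := measurable_lower_set lS.
have mr := MfunW lS.1 (@Mfun_rearrangement R L h).
have rS s : S s -> rearrangement L h b <= rearrangement L h s.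
  by move=> Ss; apply: rearrangement_le; rewrite -lee_fin -muS lower_set_ge.
have rNS s : itv0 L s -> ~ S s -> rearrangement L h s <= rearrangement L h b.
  move=> [s0 _] Ss; apply: rearrangement_le; rewrite -lee_fin -muS.
  by rewrite lower_set_le.
(* Otherwise [h*] would be infinite on all of [S], which has positive measure, against the finite
   integral. *)
have rfin : rearrangement L h b \is a fin_num.
  rewrite ge0_fin_numE ?rearrangement_ge0 // ltey; apply/eqP => roo.
  move: fin; apply/negP; rewrite -leNgt.
  have <- : \int[mu]_(s in S) (cst +oo) s = +oo.
    rewrite (@integral_cst _ _ _ mu) //.
    by transitivity (+oo * b%:E); [congr (_ * _)|rewrite gt0_mulye].
  apply: ge0_le_integral => // s Ss; first by rewrite leey.
  by rewrite /= -roo; exact: rS.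
exists (fine (rearrangement L h b)); first by rewrite fine_ge0 ?rearrangement_ge0.
set c := fine _; have cE : c%:E = rearrangement L h b by rewrite fineK.
have c0 : (0 <= c)%R by rewrite -lee_fin cE rearrangement_ge0.
rewrite -integral_excess_rearrangement //.
have -> : \int[mu]_(s in itv0 L) excess (rearrangement L h) c s =
          \int[mu]_(s in S) excess (rearrangement L h) c s.
  rewrite integral_mkcond [RHS]integral_mkcond; apply: eq_integral => s _.
  rewrite !patchE; case: ifPn => [sI|/negP sI]; last first.
    by rewrite memNset // => /lS.1 /mem_set.
  case: ifPn => // /negP Ss; rewrite inE in sI.
  rewrite /excess; apply/max_idPr; rewrite leeBlDr // add0e cE.
  by rewrite gee0_abs ?rearrangement_ge0 // rNS // => /mem_set.
have mex := MfunW lS.1 (Mfun_excess c (@Mfun_rearrangement R L h)).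
rewrite -muS -(@integral_cst _ _ _ mu) // -ge0_integralD //; last first.
  by move=> s _; exact: excess_ge0.
apply: (@ge0_le_integral _ _ _ mu _ mS).
- by move=> s _; rewrite adde_ge0 ?excess_ge0 ?lee_fin.
- by apply: emeasurable_funD => //; exact: measurable_cst.
- exact: mr.
- move=> s Ss /=; rewrite /excess gee0_abs ?rearrangement_ge0 //.
  have r_ge : 0 <= rearrangement L h s - c%:E.
    by rewrite sube_ge0 // cE; exact: rS.
  by rewrite (elimT max_idPl r_ge) addeC subeK.
Qed.

(** Prepares (P5), where [E] is unrelated to [S]. For the [c] optimal on [S] and [I] the excess
    integral, [c a + I <= (1 + a / b) (c b + I)]. *)
Lemma rearrangement_abs_le (S E : set R) (a b : R) h : Mfun L h ->
  lower_set S -> mu S = b%:E -> (0 < b)%R ->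
  E `<=` itv0 L -> measurable (E : set (LebR R)) -> mu E = a%:E ->
  \int[mu]_(s in E) `|h s| <=
  (1 + a / b)%:E * \int[mu]_(s in S) rearrangement L h s.
Proof.
move=> mh lS muS b0 EI mE muE.
have a0 : (0 <= a)%R by rewrite -lee_fin -muE measure_ge0.
have k0 : (0 < 1 + a / b)%R by rewrite ltr_wpDr // divr_ge0 // ltW.
have [fin|] := ltP (\int[mu]_(s in S) rearrangement L h s) +oo; last first.
  by rewrite leye_eq => /eqP ->; rewrite gt0_muley ?lte_fin // leey.
have [c c0 cle] := excess_le_integral mh lS muS b0 fin.
apply: (le_trans (integral_le_excess mh c0 EI mE)); rewrite muE.
have int0 : 0 <= \int[mu]_(s in itv0 L) excess h c s.
  by apply: integral_ge0 => s _; exact: excess_ge0.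
apply: le_trans (lee_wpmul2l _ cle); last by rewrite lee_fin ltW.
rewrite ge0_muleDr ?mule_ge0 ?lee_fin ?(ltW b0) //; apply: leeD.
  rewrite -!EFinM lee_fin mulrC (mulrC c b) mulrA ler_wpM2r //.
  by rewrite mulrDl mul1r mulfVK ?gt_eqF // lerDr ltW.
by rewrite lee_pemull // lee_fin lerDl divr_ge0 // ltW.
Qed.

Lemma hardy_littlewood_lower S h : Mfun L h -> lower_set S -> mu S < +oo ->
  \int[mu]_(s in S) `|h s| <= \int[mu]_(s in S) rearrangement L h s.
Proof.
move=> mh lS Soo; have [->|S0] := lower_set_gt0 lS; first by rewrite !integral_set0.
have mS := measurable_lower_set lS.
have [fin|] := ltP (\int[mu]_(s in S) rearrangement L h s) +oo; last first.
  by rewrite leye_eq => /eqP ->; rewrite leey.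
have Sfin : mu S \is a fin_num by rewrite ge0_fin_numE // ltW.
have b0 : (0 < fine (mu S))%R by rewrite fine_gt0 // S0.
have [c c0] := excess_le_integral mh lS (esym (fineK Sfin)) b0 fin.
rewrite fineK //; apply: le_trans.
by apply: integral_le_excess => //; exact: lS.1.
Qed.

(** If [c] and [e] are optimal for [f] and [g], the level [c + e] is admissible for the sum, and the
    excess of [f + g] over [c + e] is at most the sum of the two excesses. *)
Lemma rearrangementD_lower S f g : Mfun L f -> Mfun L g -> lower_set S ->
  mu S < +oo ->
  \int[mu]_(s in S) rearrangement L (fun t => f t + g t) s <=
  \int[mu]_(s in S) rearrangement L f s + \int[mu]_(s in S) rearrangement L g s.
Proof.
move=> mf mg lS Soo; have [->|S0] := lower_set_gt0 lS.
  by rewrite !integral_set0 adde0.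
have mS := measurable_lower_set lS.
have r0 h : 0 <= \int[mu]_(s in S) rearrangement L h s.
  by apply: integral_ge0 => s _; exact: rearrangement_ge0.
have [ffin|] := ltP (\int[mu]_(s in S) rearrangement L f s) +oo; last first.
  by rewrite leye_eq => /eqP ->; rewrite addye ?leey // gt_eqF // (lt_le_trans _ (r0 g)).
have [gfin|] := ltP (\int[mu]_(s in S) rearrangement L g s) +oo; last first.
  by rewrite leye_eq => /eqP ->; rewrite addey ?leey // gt_eqF // (lt_le_trans _ (r0 f)).
have Sfin : mu S \is a fin_num by rewrite ge0_fin_numE // ltW.
have b0 : (0 < fine (mu S))%R by rewrite fine_gt0 // S0.
have [c c0 hc] := excess_le_integral mf lS (esym (fineK Sfin)) b0 ffin.
have [e e0 he] := excess_le_integral mg lS (esym (fineK Sfin)) b0 gfin.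
have mfg : Mfun L (fun t => f t + g t) by exact: emeasurable_funD.
have ce0 : (0 <= c + e)%R by rewrite addr_ge0.
(* The bound is applied to the rearrangement of [f + g]; its excess integral is then exchanged for
   that of [f + g]. *)
have := integral_le_excess (@Mfun_rearrangement R L (fun t => f t + g t)) ce0 lS.1 mS.
under eq_integral do rewrite gee0_abs ?rearrangement_ge0 //.
rewrite integral_excess_rearrangement // => /le_trans; apply.
apply: le_trans (leeD hc he); rewrite fineK // addeACA.
have mI := @measurable_itv0 R L.
have int0 h k : 0 <= \int[mu]_(s in itv0 L) excess h k s.
  by apply: integral_ge0 => s _; exact: excess_ge0.
rewrite EFinD muleDl // leeD2l // -ge0_integralD //; first last.
- exact: Mfun_excess.
- by move=> s _; exact: excess_ge0.
- exact: Mfun_excess.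
- by move=> s _; exact: excess_ge0.
apply: (@ge0_le_integral _ _ _ mu _ mI).
- by move=> s _; exact: excess_ge0.
- exact: Mfun_excess.
- by apply: emeasurable_funD; exact: Mfun_excess.
move=> s _; rewrite /excess ge_max adde_ge0 ?excess_ge0 // andbT.
apply: (@le_trans _ _ ((`|f s| - c%:E) + (`|g s| - e%:E))); last first.
  by apply: leeD; rewrite le_max lexx.
by rewrite addeACA -fin_num_oppeD // leeD2r // lee_abs_add.
Qed.

(** * Inequalities under a nonincreasing weight *)

Context (u : R -> R).
Hypothesis u_gt0 : forall t, itv0 L t -> (0 < u t)%R.
Hypothesis u_noninc :
  forall s t, itv0 L s -> itv0 L t -> (s <= t)%R -> (u t <= u s)%R.

Lemma Mfun_weight : Mfun L (EFin \o u).
Proof. by apply: (@Mfun_mono _ _ _ false) => s t sI tI st; rewrite lee_fin u_noninc. Qed.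

Lemma itv_subset_itv0 t : itv0 L t -> `]0%R, t[ `<=` itv0 L.
Proof. by move=> [_ tL]; rewrite -itv0_EFin; apply: subset_itv0; exact: ltW. Qed.

Lemma lower_set_itv t : itv0 L t -> lower_set `]0%R, t[.
Proof.
move=> tI; split; first exact: itv_subset_itv0.
by move=> s r; rewrite /= !in_itv /= => /andP[_ rt] -> sr; rewrite (le_lt_trans sr).
Qed.

Lemma measure_itv_lty t : mu `]0%R, t[ < +oo.
Proof.
have [t0|t0] := leP 0%R t; first by rewrite -itv0_EFin measure_itv0 // ltry.
by rewrite set_itv_ge ?measure0 // bnd_simp -leNgt ltW.
Qed.

Lemma lower_set_weight t y : itv0 L t ->
  lower_set (`]0%R, t[ `&` [set s | y%:E < (u s)%:E]).
Proof.
move=> tI; have [sub low] := lower_set_itv tI; split; first by move=> s [/sub].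
move=> s r [rt yr] s0 sr; split; first exact: (low _ r).
apply: (lt_le_trans yr); rewrite lee_fin; apply: u_noninc => //; apply: sub => //.
exact: (low _ r).
Qed.

Lemma hardy_weight t (F G : R -> \bar R) : itv0 L t -> Mfun L F -> Mfun L G ->
  (forall s, itv0 L s -> 0 <= F s) -> (forall s, itv0 L s -> 0 <= G s) ->
  (forall S, lower_set S -> mu S < +oo ->
     \int[mu]_(s in S) F s <= \int[mu]_(s in S) G s) ->
  \int[mu]_(s in `]0%R, t[) (F s * (u s)%:E) <=
  \int[mu]_(s in `]0%R, t[) (G s * (u s)%:E).
Proof.
move=> tI mF mG F0 G0 FG; have sub := itv_subset_itv0 tI.
apply: le_integral_weight.
- exact: measurable_LebR_itv.
- exact: MfunW mF.
- exact: MfunW mG.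
- exact: MfunW Mfun_weight.
- by move=> s /sub /F0.
- by move=> s /sub /G0.
- by move=> s /sub /u_gt0 us; rewrite lee_fin ltW.
move=> y _; apply: FG; first exact: lower_set_weight.
apply: le_lt_trans (measure_itv_lty t); apply: le_measure; rewrite ?inE.
- by apply: measurable_lower_set; exact: lower_set_weight.
- exact: measurable_LebR_itv.
- by move=> s [].
Qed.

Lemma hardy_littlewood_weight t h : itv0 L t -> Mfun L h ->
  \int[mu]_(s in `]0%R, t[) (`|h s| * (u s)%:E) <=
  \int[mu]_(s in `]0%R, t[) (rearrangement L h s * (u s)%:E).
Proof.
move=> tI mh; apply: hardy_weight => //.
- exact: Mfun_abs.
- exact: Mfun_rearrangement.
- by move=> s _; exact: rearrangement_ge0.
- by move=> S lS Soo; exact: hardy_littlewood_lower.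
Qed.

Lemma rearrangementD_weight t f g : itv0 L t -> Mfun L f -> Mfun L g ->
  \int[mu]_(s in `]0%R, t[) (rearrangement L (fun x => f x + g x) s * (u s)%:E) <=
  \int[mu]_(s in `]0%R, t[) (rearrangement L f s * (u s)%:E) +
  \int[mu]_(s in `]0%R, t[) (rearrangement L g s * (u s)%:E).
Proof.
move=> tI mf mg; have sub := itv_subset_itv0 tI.
have mW h : measurable_fun (`]0%R, t[%classic : set (LebR R))
    ((fun s => rearrangement L h s * (u s)%:E) : LebR R -> \bar R).
  apply: (MfunW sub); apply: emeasurable_funM; first exact: Mfun_rearrangement.
  exact: Mfun_weight.
have W0 h s : `]0%R, t[%classic s -> 0 <= rearrangement L h s * (u s)%:E.
  by move=> /sub /u_gt0 us; rewrite mule_ge0 ?rearrangement_ge0 // lee_fin ltW.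
(* The two weighted integrals are merged, so that [hardy_weight] has a single function [f* + g*] to
   compare with. *)
rewrite -ge0_integralD //; [|exact: measurable_LebR_itv|exact: W0|exact: W0].
under [leRHS]eq_integral => s _.
  rewrite -ge0_muleDl ?rearrangement_ge0 //; over.
apply: hardy_weight => //.
- exact: Mfun_rearrangement.
- by apply: emeasurable_funD; exact: Mfun_rearrangement.
- by move=> s _; exact: rearrangement_ge0.
- by move=> s _; rewrite adde_ge0 ?rearrangement_ge0.
move=> S lS Soo; rewrite ge0_integralD //; first exact: rearrangementD_lower.
- exact: measurable_lower_set.
- by move=> s _; exact: rearrangement_ge0.
- by apply: (MfunW lS.1); exact: Mfun_rearrangement.
- by move=> s _; exact: rearrangement_ge0.
- by apply: (MfunW lS.1); exact: Mfun_rearrangement.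
Qed.

End lower_sets.

(** * Rearrangements under scaling, order almost everywhere and monotone limits *)

Section rearrangement_properties.
Local Open Scope ereal_scope.
Context (R : realType).
Local Notation mu := (@completed_lebesgue_measure R).
Context (L : \bar R).
Implicit Types (f g h : R -> \bar R) (s t l : R).

Lemma ae0S (P Q : R -> Prop) : (forall t, itv0 L t -> P t -> Q t) ->
  ae0 L P -> ae0 L Q.
Proof.
move=> PQ [N [mN N0 NP]]; exists N; split => // t /= nQ; apply: NP => /= nP.
by apply: nQ => tI; apply: PQ => //; exact: nP.
Qed.

Lemma ae0_foralln (P : nat -> R -> Prop) : (forall n, ae0 L (P n)) ->
  ae0 L (fun t => forall n, P n t).
Proof.
move=> /ae_foralln [N [mN N0 NP]]; exists N; split => // t /= nP; apply: NP => /= h.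
by apply: nP => tI n; exact: h.
Qed.

Lemma ae0I (P Q : R -> Prop) : ae0 L P -> ae0 L Q -> ae0 L (fun t => P t /\ Q t).
Proof.
move=> aP aQ; have := @ae0_foralln (fun n => if n is 0%N then P else Q).
have h n : ae0 L (if n is 0%N then P else Q) by case: n.
by move=> /(_ h); apply: ae0S => t _ PQ; split; [exact: (PQ 0%N)|exact: (PQ 1%N)].
Qed.

(** The distribution function of [a f] at [l] is that of [f] at [l / a]; both sides then exceed the
    same real levels. *)
Lemma rearrangementZ (a : R) f s : (0 < a)%R -> Mfun L f ->
  rearrangement L (fun t => a%:E * f t) s = a%:E * rearrangement L f s.
Proof.
move=> a0 mf; have maf : Mfun L (fun t => a%:E * f t).
  by apply: emeasurable_funM => //; exact: measurable_cst.
have DE l : distribution_fun L (fun t => a%:E * f t) l = distribution_fun L f (a^-1 * l)%R.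
  have E t : (l%:E < `|a%:E * f t|) = ((a^-1 * l)%:E < `|f t|).
    by rewrite EFinM lte_pdivrMl // abseM gee0_abs // lee_fin ltW.
  rewrite /distribution_fun; congr (mu _).
  by apply/seteqP; split => t /= [tI]; rewrite E.
have E l : (0 <= l)%R -> (l%:E < rearrangement L (fun t => a%:E * f t) s) =
    (l%:E < a%:E * rearrangement L f s).
  move=> l0; rewrite lt_rearrangement // DE -lt_rearrangement //; last first.
    by rewrite mulr_ge0 // invr_ge0 ltW.
  by rewrite EFinM lte_pdivrMl.
apply/eqP; rewrite eq_le; apply/andP; split; apply: lte_ge0_imp_le.
- by rewrite mule_ge0 ?rearrangement_ge0 // lee_fin ltW.
- by move=> l l0; rewrite E.
- exact: rearrangement_ge0.
- by move=> l l0; rewrite E.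
Qed.

Lemma ae_le_distribution_fun f g l : Mfun L f -> Mfun L g ->
  ae0 L (fun t => `|f t| <= `|g t|) ->
  distribution_fun L f l <= distribution_fun L g l.
Proof.
move=> mf mg [N [mN muN fgN]]; have mfl := measurable_superlevel l mf.
have mgl := measurable_superlevel l mg.
have -> : distribution_fun L g l = distribution_fun L g l + mu N.
  by rewrite (_ : mu N = 0) ?adde0.
apply: (@le_trans _ _ (mu (superlevel L g l `|` N))); last exact: measureU2.
apply: le_measure; rewrite ?inE //; first exact: measurableU.
move=> t [tI lt]; have [Nt|Nt] := pselect (N t); [by right|left].
split => //; apply: (lt_le_trans lt); apply: contrapT => h.
by apply: Nt; apply: fgN => /(_ tI).
Qed.

Lemma ae_le_rearrangement f g s : Mplus L f -> Mplus L g ->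
  ae0 L (fun t => f t <= g t) -> rearrangement L f s <= rearrangement L g s.
Proof.
move=> [mf f0] [mg g0] fg; apply: le_rearrangement => l l0.
apply: ae_le_distribution_fun => //; move: (ae0I f0 (ae0I g0 fg)).
by apply: ae0S => t _ [ft0 [gt0 ftgt]]; rewrite !gee0_abs.
Qed.

Lemma rearrangement_eq0 f s : (0 < s)%R -> Mfun L f ->
  ae0 L (fun t => f t = 0) -> rearrangement L f s = 0.
Proof.
move=> s0 mf f0; apply/eqP; rewrite eq_le rearrangement_ge0 andbT leNgt.
rewrite lt_rearrangement // -leNgt.
have m0 : Mfun L (cst 0) by exact: measurable_cst.
apply: le_trans (ae_le_distribution_fun 0%R mf m0 _) _.
  by apply: ae0S f0 => t _ ->.
rewrite /distribution_fun (_ : [set s | _] = set0) ?measure0 ?lee_fin ?ltW //.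
by apply/seteqP; split => t //= -[_]; rewrite normr0 ltxx.
Qed.

Lemma rearrangement_indic_le1 (E : set R) s : (0 < s)%R -> Mfun L (fun t => (\1_E t)%:E) ->
  rearrangement L (fun t => (\1_E t)%:E) s <= 1.
Proof.
move=> s0 mE; rewrite leNgt lt_rearrangement // -leNgt.
rewrite /distribution_fun (_ : [set s | _] = set0) ?measure0 ?lee_fin ?ltW //.
apply/seteqP; split => t //= -[_]; rewrite indicE lte_fin.
by case: (t \in E) => /=; rewrite ?normr1 ?normr0 ?ltxx // ltNge ler01.
Qed.

(** With [rearrangement_indic_le1], this dominates the rearrangement by the indicator of the
    interval from 0 to [mu E]. *)
Lemma rearrangement_indic_eq0 (E : set R) s : E `<=` itv0 L ->
  Mfun L (fun t => (\1_E t)%:E) -> mu E <= s%:E ->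
  rearrangement L (fun t => (\1_E t)%:E) s = 0.
Proof.
move=> EI mE Es; apply/eqP; rewrite eq_le rearrangement_ge0 andbT leNgt.
rewrite lt_rearrangement // -leNgt; apply: le_trans Es.
rewrite /distribution_fun (_ : [set s | _] = E) //.
apply/seteqP; split => t /=.
  move=> [_]; rewrite indicE; case: (boolP (t \in E)) => [/set_mem //|_].
  by rewrite /= normr0 ltxx.
move=> Et; split; first exact: EI.
by rewrite indicE mem_set //= normr1 lte_fin ltr01.
Qed.

(** Off a null set, the superlevel sets of [f_ k] increase to that of [f]. If [s] is below the
    distribution function of [f] at [l], continuity of the measure from below puts it below that of
    some [f_ k], so every level under the limit is exceeded. *)
Lemma cvg_rearrangement (f_ : nat -> R -> \bar R) f s :
  (forall k, Mplus L (f_ k)) -> Mplus L f ->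
  ae0 L (fun t => nondecreasing_seq (f_ ^~ t) /\ f_ k t @[k --> \oo] --> f t) ->
  nondecreasing_seq (fun k => rearrangement L (f_ k) s) /\
  rearrangement L (f_ k) s @[k --> \oo] --> rearrangement L f s.
Proof.
move=> mf_ mf fcvg.
have nd : nondecreasing_seq (fun k => rearrangement L (f_ k) s).
  move=> k m km; apply: ae_le_rearrangement => //.
  by apply: ae0S fcvg => t _ [nd _]; exact: nd.
split => //; have := ereal_nondecreasing_cvgn nd.
set S := ereal_sup _; suff -> : rearrangement L f s = S by [].
apply/eqP; rewrite eq_le; apply/andP; split; last first.
  apply: ge_ereal_sup => _ [k _ <-]; apply: ae_le_rearrangement => //.
  apply: ae0S fcvg => t _ [ndt cvgt].
  rewrite -(cvg_lim _ cvgt) //; apply: lime_ge; first by apply/cvg_ex; eexists; exact: cvgt.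
  by exists k => // m /= km; exact: ndt.
apply: lte_ge0_imp_le.
  by apply: le_trans (ereal_sup_ubound _); [exact: (rearrangement_ge0 L (f_ 0%N) s)|exists 0%N].
move=> l l0; rewrite lt_rearrangement; [|exact: mf.1|by []] => sDf.
suff [k] : exists k, s%:E < distribution_fun L (f_ k) l.
  rewrite -lt_rearrangement //; last exact: (mf_ k).1.
  by move=> /lt_le_trans; apply; apply: ereal_sup_ubound; exists k.
apply: contrapT => hs.
have Dk k : distribution_fun L (f_ k) l <= s%:E.
  by rewrite leNgt; apply/negP => h; apply: hs; exists k.
have : ae0 L (fun t => (forall k, 0 <= f_ k t) /\
    (nondecreasing_seq (f_ ^~ t) /\ f_ k t @[k --> \oo] --> f t)).
  exact: ae0I (ae0_foralln (fun k => (mf_ k).2)) fcvg.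
move=> [N [mN muN hN]].
(* Removing the exceptional set makes the sequence of sets nondecreasing, as continuity from below
   requires. *)
pose A k := superlevel L (f_ k) l `\` N.
have mA k : measurable (A k : set (LebR R)).
  by apply: measurableD => //; apply: measurable_superlevel; exact: (mf_ k).1.
have good t : itv0 L t -> ~ N t -> (forall k, 0 <= f_ k t) /\
    (nondecreasing_seq (f_ ^~ t) /\ f_ k t @[k --> \oo] --> f t).
  by move=> tI Nt; apply: contrapT => h; apply: Nt; apply: hN => /(_ tI).
have A_nd : nondecreasing_seq A.
  move=> k m km; apply/subsetPset => t [[tI lt] Nt]; split => //; split => //.
  have [f0 [ndt _]] := good t tI Nt.
  by rewrite gee0_abs // (lt_le_trans _ (ndt _ _ km)) // -[ltRHS]gee0_abs.
have cvgA := @nondecreasing_cvg_mu _ _ _ mu A mA (bigcup_measurable (fun n _ => mA n)) A_nd.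
have : distribution_fun L f l <= mu (\bigcup_k A k) + mu N.
  apply: (@le_trans _ _ (mu ((\bigcup_k A k) `|` N))).
    apply: le_measure; rewrite ?inE.
    - by apply: measurable_superlevel; exact: mf.1.
    - by apply: measurableU => //; exact: bigcup_measurable.
    - move=> t [tI lt]; have [Nt|Nt] := pselect (N t); [by right|left].
      have [f0 [_ cvgt]] := good t tI Nt; apply: contrapT => hA.
      have ft0 : 0 <= f t.
        rewrite -(cvg_lim _ cvgt) //; apply: lime_ge; last exact: nearW.
        by apply/cvg_ex; eexists; exact: cvgt.
      move: lt; apply/negP; rewrite -leNgt gee0_abs // -(cvg_lim _ cvgt) //.
      apply: lime_le; first by apply/cvg_ex; eexists; exact: cvgt.
      apply: nearW => k; rewrite leNgt; apply/negP => lk; apply: hA.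
      by exists k => //; split => //; split => //; rewrite gee0_abs.
  by apply: measureU2 => //; exact: bigcup_measurable.
rewrite (_ : mu N = 0) // adde0 => /(lt_le_trans sDf); apply/negP; rewrite -leNgt.
rewrite -(cvg_lim _ cvgA) //; apply: lime_le; first by apply/cvg_ex; eexists; exact: cvgA.
apply: nearW => k; apply: le_trans (Dk k); apply: le_measure; rewrite ?inE //.
- by apply: measurable_superlevel; exact: (mf_ k).1.
- by move=> t [].
Qed.

End rearrangement_properties.

(** * Elementary consequences of the norm axioms *)

Section ri_norm_properties.
Local Open Scope ereal_scope.
Context (R : realType) (L : \bar R) (rho : (R -> \bar R) -> \bar R).
Local Notation mu := (@completed_lebesgue_measure R).
Hypothesis rhoP : ri_norm L rho.
Implicit Types (f g h : R -> \bar R).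

Lemma ri_norm_le_in f g : Mplus L f -> Mplus L g ->
  (forall t, itv0 L t -> f t <= g t) -> rho f <= rho g.
Proof. by move=> mf mg fg; apply: (ri_norm_le rhoP) => //; exact: aeW. Qed.

Lemma ri_norm_eq_in f g : Mplus L f -> Mplus L g ->
  (forall t, itv0 L t -> f t = g t) -> rho f = rho g.
Proof.
move=> mf mg fg; apply/eqP; rewrite eq_le.
by apply/andP; split; apply: ri_norm_le_in => // t /fg ->.
Qed.

(** Homogeneity is an axiom for real factors, while [B] will be an integral that may be infinite;
    that case is reached through all real factors below [B]. *)
Lemma ri_norm_scale_le (B : \bar R) f g : 0 <= B -> Mplus L f -> Mplus L g ->
  (forall t, itv0 L t -> 0 <= f t) ->
  (forall t, itv0 L t -> B * f t <= g t) -> B * rho f <= rho g.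
Proof.
move=> B0 mf mg f0 fg; have mZ (a : R) : (0 <= a)%R -> Mplus L (fun t => a%:E * f t).
  move=> a0; apply: MplusI; last by move=> t tI; rewrite mule_ge0 // f0.
  by apply: emeasurable_funM; [exact: measurable_cst|exact: mf.1].
have le a : (0 <= a)%R -> a%:E <= B -> a%:E * rho f <= rho g.
  move=> a0 aB; rewrite -(ri_normZ rhoP) //; apply: ri_norm_le_in => //; first exact: mZ.
  by move=> t tI; apply: le_trans (fg _ tI); rewrite lee_wpmul2r // f0.
case: B B0 fg le => [B| |] // B0 fg le; first exact: le.
have [->|rf0] := eqVneq (rho f) 0; first by rewrite mule0 (ri_norm_ge0 rhoP).
have {}rf0 : 0 < rho f by rewrite lt0e rf0 (ri_norm_ge0 rhoP).
(* For [B = +oo], [rho g] exceeds every [A]: use the factor [A / rho f], or 1 if [rho f] is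
   infinite. *)
rewrite gt0_mulye // leye_eq; apply/eqP/eqyP => A A0.
case E : (rho f) rf0 => [r| |] // rf0.
- have := le (A / r)%R _ (leey _); rewrite E -EFinM mulfVK; last by rewrite gt_eqF.
  by apply; rewrite divr_ge0 // ltW.
- have := le 1%R ler01 (leey _); rewrite E mul1e; apply: le_trans; exact: leey.
Qed.

Lemma abs_norm_ge0 f : Mfun L f -> 0 <= abs_norm rho f.
Proof.
move=> mf; apply: (ri_norm_ge0 rhoP); apply: MplusI; first exact: Mfun_abs.
by move=> t _.
Qed.

End ri_norm_properties.

(** * The functional [varrho] and its norm properties *)

Section weighted_hardy_operator.
Local Open Scope ereal_scope.
Context (R : realType) (L : \bar R) (X : (R -> \bar R) -> \bar R) (u v nu : R -> R).
Local Notation mu := (@completed_lebesgue_measure R).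
Hypothesis L_gt0 : 0 < L.
Hypothesis XP : ri_norm L X.
Hypothesis u_gt0 : forall t, itv0 L t -> (0 < u t)%R.
Hypothesis u_nondeg : nondegenerate_weight L u.
Hypothesis u_noninc :
  forall s t, itv0 L s -> itv0 L t -> (s <= t)%R -> (u t <= u s)%R.
Hypothesis v_gt0 : forall t, itv0 L t -> (0 < v t)%R.
Hypothesis v_meas : measurable_fun (itv0 L : set (LebR R)) (v : LebR R -> R).
Hypothesis nu_itv0 : forall t, itv0 L t -> itv0 L (nu t).
Hypothesis nu_incr :
  forall s t, itv0 L s -> itv0 L t -> (s < t)%R -> (nu s < nu t)%R.
Implicit Types (f g h F G : R -> \bar R) (s t : R) (E : set R).

Let L_ge0 : 0 <= L := ltW L_gt0.

Local Notation rearr := (rearrangement L).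

(** Common form of the operator, with [F = |g|], of the function inside [varrho], with [F = f*], and
    of the product of [v] and [U] after [nu], with [F = 1]. *)
Definition hardy F t : \bar R :=
  (v t)%:E * \int[mu]_(s in `]0%R, nu t[) (F s * (u s)%:E).

Let nu_le s t : itv0 L s -> itv0 L t -> (s <= t)%R -> (nu s <= nu t)%R.
Proof.
move=> sI tI; rewrite le_eqVlt => /predU1P[->//|st].
by apply: ltW; exact: nu_incr.
Qed.

Lemma measurable_fun_weight t F : itv0 L t -> Mfun L F ->
  measurable_fun (`]0%R, t[%classic : set (LebR R))
    ((fun s => F s * (u s)%:E) : LebR R -> \bar R).
Proof.
move=> tI mF; apply: (MfunW (itv_subset_itv0 tI)).
by apply: emeasurable_funM; [exact: mF|exact: Mfun_weight].
Qed.

Lemma weight_integrand_ge0 t F s : itv0 L t -> (forall s, itv0 L s -> 0 <= F s) ->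
  `]0%R, t[%classic s -> 0 <= F s * (u s)%:E.
Proof.
move=> tI F0 /(itv_subset_itv0 tI) sI.
by rewrite mule_ge0 ?F0 // lee_fin ltW // u_gt0.
Qed.

Lemma weight_integral_ge0 t F : itv0 L t -> (forall s, itv0 L s -> 0 <= F s) ->
  0 <= \int[mu]_(s in `]0%R, t[) (F s * (u s)%:E).
Proof. by move=> tI F0; apply: integral_ge0 => s; exact: weight_integrand_ge0. Qed.

Lemma weight_integral_le s t F : itv0 L s -> itv0 L t -> (s <= t)%R -> Mfun L F ->
  (forall r, itv0 L r -> 0 <= F r) ->
  \int[mu]_(r in `]0%R, s[) (F r * (u r)%:E) <=
  \int[mu]_(r in `]0%R, t[) (F r * (u r)%:E).
Proof.
move=> sI tI st mF F0; apply: ge0_subset_integral.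
- exact: measurable_LebR_itv.
- exact: measurable_LebR_itv.
- exact: measurable_fun_weight.
- by move=> r; exact: weight_integrand_ge0.
- by move=> r /=; rewrite !in_itv /= => /andP[-> /lt_le_trans]; apply.
Qed.

Lemma hardy_ge0 F t : itv0 L t -> (forall s, itv0 L s -> 0 <= F s) -> 0 <= hardy F t.
Proof.
move=> tI F0; rewrite mule_ge0 //; first by rewrite lee_fin ltW // v_gt0.
by apply: weight_integral_ge0 => //; exact: nu_itv0.
Qed.

(** The integral is nondecreasing in [t] because [nu] is, hence measurable, and [v] is
    measurable. *)
Lemma Mplus_hardy F : Mfun L F -> (forall s, itv0 L s -> 0 <= F s) -> Mplus L (hardy F).
Proof.
move=> mF F0; apply: MplusI; last by move=> t tI; exact: hardy_ge0.
apply: emeasurable_funM; first exact/measurable_EFinP.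
apply: (@Mfun_mono _ _ _ true) => s t sI tI st.
by apply: weight_integral_le => //; [exact: nu_itv0|exact: nu_itv0|exact: nu_le].
Qed.

Lemma hardy_le F G t : itv0 L t -> Mfun L F -> Mfun L G ->
  (forall s, itv0 L s -> 0 <= F s) -> (forall s, itv0 L s -> F s <= G s) ->
  hardy F t <= hardy G t.
Proof.
move=> tI mF mG F0 FG; apply: lee_wpmul2l; first by rewrite lee_fin ltW // v_gt0.
have ntI := nu_itv0 tI; apply: ge0_le_integral.
- exact: measurable_LebR_itv.
- by move=> s; exact: weight_integrand_ge0.
- exact: measurable_fun_weight.
- exact: measurable_fun_weight.
- move=> s /(itv_subset_itv0 ntI) sI.
  by rewrite lee_wpmul2r ?FG // lee_fin ltW // u_gt0.
Qed.

Lemma hardy_eq F G t : itv0 L t -> (forall s, itv0 L s -> F s = G s) ->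
  hardy F t = hardy G t.
Proof.
move=> tI FG; congr (_ * _); apply: eq_integral => s; rewrite inE.
by move=> /(itv_subset_itv0 (nu_itv0 tI)) /FG ->.
Qed.

Lemma Rop_hardy g : Rop u v nu g = hardy (fun t => `|g t|).
Proof. by []. Qed.

Lemma varrho_hardy f : varrho L X u v nu f = X (hardy (rearr f)).
Proof. by []. Qed.

Lemma Mplus_hardy_rearrangement f : Mplus L (hardy (rearr f)).
Proof.
by apply: Mplus_hardy; [exact: Mfun_rearrangement|move=> s _; exact: rearrangement_ge0].
Qed.

Lemma varrho_ge0 f : 0 <= varrho L X u v nu f.
Proof. by apply: (ri_norm_ge0 XP); exact: Mplus_hardy_rearrangement. Qed.

Lemma varrho_abs f : varrho L X u v nu (fun t => `|f t|) = varrho L X u v nu f.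
Proof. by rewrite !varrho_hardy rearrangement_abs. Qed.

Lemma varrho_le f g : Mplus L f -> Mplus L g -> ae0 L (fun t => f t <= g t) ->
  varrho L X u v nu f <= varrho L X u v nu g.
Proof.
move=> mf mg fg; rewrite !varrho_hardy; apply: (ri_norm_le_in XP).
- exact: Mplus_hardy_rearrangement.
- exact: Mplus_hardy_rearrangement.
- move=> t tI; apply: hardy_le => //; try exact: Mfun_rearrangement.
    by move=> s _; exact: rearrangement_ge0.
  by move=> s _; exact: ae_le_rearrangement.
Qed.

Lemma varrho_eq0_of_ae0 f : Mfun L f -> ae0 L (fun t => f t = 0) ->
  varrho L X u v nu f = 0.
Proof.
move=> mf f0; rewrite varrho_hardy.
apply/(ri_norm_eq0 XP (Mplus_hardy_rearrangement f)); apply: aeW => t tI.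
rewrite /hardy integral0_eq ?mule0 // => s; rewrite /= in_itv /= => /andP[s0 _].
by rewrite (rearrangement_eq0 s0) // mul0e.
Qed.

Lemma varrhoZ (a : R) f : (0 <= a)%R -> Mplus L f ->
  varrho L X u v nu (fun t => a%:E * f t) = a%:E * varrho L X u v nu f.
Proof.
(* [rearrangementZ] asks for [a > 0]; for [a = 0] both sides vanish. *)
rewrite le_eqVlt => /predU1P[<-|a0] mf.
  rewrite mul0e; apply: varrho_eq0_of_ae0.
    by apply: emeasurable_funM; [exact: measurable_cst|exact: mf.1].
  by apply: aeW => t _; rewrite mul0e.
rewrite !varrho_hardy -(ri_normZ XP) ?(ltW a0) //; last exact: Mplus_hardy_rearrangement.
apply: (ri_norm_eq_in XP); first exact: Mplus_hardy_rearrangement.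
  apply: MplusI => [|t tI].
    by apply: emeasurable_funM; [exact: measurable_cst|exact: (Mplus_hardy_rearrangement f).1].
  rewrite mule_ge0 //; first by rewrite lee_fin ltW.
  by apply: hardy_ge0 => // s _; exact: rearrangement_ge0.
move=> t tI; rewrite /hardy muleCA; congr (_ * _).
have -> : \int[mu]_(s in `]0%R, nu t[) (rearr (fun x => a%:E * f x) s * (u s)%:E) =
    \int[mu]_(s in `]0%R, nu t[) (a%:E * (rearr f s * (u s)%:E)).
  by apply: eq_integral => s _; rewrite rearrangementZ ?muleA //; exact: mf.1.
rewrite (@ge0_integralZl _ _ _ mu); first by [].
- exact: measurable_LebR_itv.
- by apply: measurable_fun_weight; [exact: nu_itv0|exact: Mfun_rearrangement].
- move=> s; apply: weight_integrand_ge0; first exact: nu_itv0.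
  by move=> r _; exact: rearrangement_ge0.
- by rewrite lee_fin ltW.
Qed.

Lemma varrhoD f g : Mplus L f -> Mplus L g ->
  varrho L X u v nu (fun t => f t + g t) <= varrho L X u v nu f + varrho L X u v nu g.
Proof.
move=> mf mg; rewrite !varrho_hardy.
have mr := Mplus_hardy_rearrangement.
apply: le_trans (ri_normD XP (mr f) (mr g)).
apply: (ri_norm_le_in XP) => //.
  apply: MplusI => [|t tI]; first by apply: emeasurable_funD; [exact: (mr f).1|exact: (mr g).1].
  by rewrite adde_ge0 //; apply: hardy_ge0 => // s _; exact: rearrangement_ge0.
move=> t tI; have ntI := nu_itv0 tI.
rewrite /hardy -ge0_muleDr; last 2 first.
- by apply: weight_integral_ge0 => // s _; exact: rearrangement_ge0.
- by apply: weight_integral_ge0 => // s _; exact: rearrangement_ge0.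
apply: lee_wpmul2l; first by rewrite lee_fin ltW // v_gt0.
by apply: rearrangementD_weight => //; [exact: mf.1|exact: mg.1].
Qed.

Lemma varrho_cvg (f_ : nat -> R -> \bar R) f :
  (forall k, Mplus L (f_ k)) -> Mplus L f ->
  ae0 L (fun t => nondecreasing_seq (f_ ^~ t) /\ f_ k t @[k --> \oo] --> f t) ->
  nondecreasing_seq (fun k => varrho L X u v nu (f_ k)) /\
  varrho L X u v nu (f_ k) @[k --> \oo] --> varrho L X u v nu f.
Proof.
move=> mf_ mf fcvg.
apply: (ri_norm_cvg XP (f_ := fun k => hardy (rearr (f_ k))) (f := hardy (rearr f))).
- by move=> k; exact: Mplus_hardy_rearrangement.
- exact: Mplus_hardy_rearrangement.
apply: aeW => t tI; have ntI := nu_itv0 tI.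
have nd s : nondecreasing_seq (fun k => rearr (f_ k) s).
  by have [] := cvg_rearrangement s mf_ mf fcvg.
have cvgr s : rearr (f_ k) s @[k --> \oo] --> rearr f s.
  by have [] := cvg_rearrangement s mf_ mf fcvg.
split.
  move=> k m km; apply: hardy_le => //; try exact: Mfun_rearrangement.
    by move=> s _; exact: rearrangement_ge0.
  by move=> s _; exact: nd.
apply: cvgeZl => //.
have -> : \int[mu]_(s in `]0%R, nu t[) (rearr f s * (u s)%:E) =
    \int[mu]_(s in `]0%R, nu t[) limn (fun k => rearr (f_ k) s * (u s)%:E).
  by apply: eq_integral => s _; apply/esym/cvg_lim => //; exact: cvgeZr.
apply: cvg_monotone_convergence.
- exact: measurable_LebR_itv.
- by move=> k; apply: measurable_fun_weight => //; exact: Mfun_rearrangement.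
- move=> k s; apply: weight_integrand_ge0 => // r _; exact: rearrangement_ge0.
- move=> s /(itv_subset_itv0 ntI) sI k m km.
  by rewrite lee_wpmul2r ?nd // lee_fin ltW // u_gt0.
Qed.

(** For [t] in [J = ]t0, t1[] and [b = nu t0], the integral up to [nu t] is at least its value [B]
    up to [b]. Hence [varrho f] is at least [B] times the norm of [min(v, 1)] on [J]. Moreover [B]
    is at least [u b] times the integral of [f*] over []0, b[], and [rearrangement_abs_le] passes
    from there to [E]. *)
Lemma varrho_integral E : finite_measure_subset L E ->
  exists2 C : R, (0 < C)%R & forall f, Mfun L f ->
    \int[mu]_(t in E) `|f t| <= C%:E * varrho L X u v nu f.
Proof.
move=> [mE EI Eoo]; have [t1 t1I _] := u_nondeg.
have t1_gt0 : (0 < t1)%R by have [] := t1I.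
pose t0 := (t1 / 2)%R; have t0_gt0 : (0 < t0)%R by rewrite divr_gt0.
have t01 : (t0 < t1)%R by rewrite ltr_pdivrMr // ltr_pMr // ltr1n.
have t0I : itv0 L t0.
  by split => //; apply: lt_trans t1I.2; rewrite lte_fin.
pose b := nu t0; have bI : itv0 L b := nu_itv0 t0I.
have b_gt0 : (0 < b)%R by have [] := bI.
pose J := `]t0, t1[%classic : set R.
have JI : J `<=` itv0 L.
  move=> t; rewrite /J /= in_itv /= => /andP[t0t tt1]; split.
    by rewrite lte_fin (lt_trans t0_gt0).
  by apply: lt_trans t1I.2; rewrite lte_fin.
have mJ : measurable (J : set (LebR R)) by exact: measurable_LebR_itv.
have muJ : mu J = (t1 - t0)%:E.
  have -> : mu J = lebesgue_measure J by [].
  by rewrite lebesgue_measure_itv /= lte_fin t01.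
(* Being at most the indicator of [J], [w] has finite norm; being positive on [J], it has nonzero
   norm. *)
pose w t := (Num.min (v t) 1 * \1_J t)%:E.
have mindic : Mfun L (fun t => (\1_J t)%:E).
  apply/measurable_EFinP; exact: measurable_indic.
have mw : Mfun L w.
  apply/measurable_EFinP; apply: measurable_funM.
    by apply: measurable_minr => //; exact: measurable_cst.
  exact: measurable_indic.
have w0 t : itv0 L t -> 0 <= w t.
  by move=> tI; rewrite lee_fin mulr_ge0 // le_min ler01 andbT ltW // v_gt0.
have Mw : Mplus L w by exact: MplusI.
have Xw_fin : X w < +oo.
  apply: le_lt_trans (ri_norm_indic XP (E := J) _); last first.
    by split => //; rewrite muJ ltry.
  apply: (ri_norm_le_in XP) => //; first by apply: MplusI => // t _; rewrite lee_fin.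
  by move=> t tI; rewrite lee_fin ler_piMl // ge_min lexx orbT.
have Xw_gt0 : 0 < X w.
  rewrite lt0e (ri_norm_ge0 XP) // andbT; apply/eqP => /(ri_norm_eq0 XP Mw) [N [mN muN wN]].
  have : mu J <= mu N.
    apply: le_measure; rewrite ?inE // => t Jt; apply: wN => /(_ (JI _ Jt)).
    rewrite /w indicE mem_set // mulr1 => -[] /eqP; apply/negP.
    by rewrite gt_eqF // lt_min ltr01 andbT; apply: v_gt0; exact: JI.
  by rewrite muJ (_ : mu N = 0) // lee_fin leNgt subr_gt0 t01.
have Xw_num : X w \is a fin_num by rewrite ge0_fin_numE // ltW.
pose c := fine (X w); have c_gt0 : (0 < c)%R by rewrite fine_gt0 // Xw_gt0.
have E_num : mu E \is a fin_num by rewrite ge0_fin_numE.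
pose a := fine (mu E); have a_ge0 : (0 <= a)%R by rewrite fine_ge0.
have ub_gt0 := u_gt0 bI.
pose k := (1 + a / b)%R.
have k_gt0 : (0 < k)%R by rewrite ltr_wpDr // divr_ge0 // ltW.
(* The factors account for the passage from [E] to []0, b[], for [u >= u b] on []0, b[], and for the
   norm [c] of [w]. *)
exists (k * (u b)^-1 * c^-1)%R; first by rewrite !mulr_gt0 // invr_gt0.
move=> f mf; have lb := lower_set_itv bI.
pose B := \int[mu]_(s in `]0%R, b[) (rearr f s * (u s)%:E).
have B0 : 0 <= B by apply: weight_integral_ge0 => // s _; exact: rearrangement_ge0.
have BX : B * c%:E <= varrho L X u v nu f.
  rewrite fineK // varrho_hardy; apply: (ri_norm_scale_le XP) => //.
    exact: Mplus_hardy_rearrangement.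
  move=> t tI; rewrite /w indicE; case: (boolP (t \in J)) => [/set_mem Jt|_]; last first.
    rewrite mulr0 mule0; apply: hardy_ge0 => // s _; exact: rearrangement_ge0.
  rewrite mulr1 /hardy muleC; apply: lee_pmul => //.
  - by rewrite lee_fin le_min ler01 andbT ltW // v_gt0.
  - by rewrite lee_fin ge_min lexx.
  - apply: weight_integral_le => //; [exact: nu_itv0| |exact: Mfun_rearrangement|].
      by apply: nu_le => //; move: Jt; rewrite /J /= in_itv /= => /andP[/ltW].
    by move=> s _; exact: rearrangement_ge0.
have Bu : (u b)%:E * \int[mu]_(s in `]0%R, b[) rearr f s <= B.
  have mr := MfunW lb.1 (@Mfun_rearrangement R L f).
  rewrite -ge0_integralZl //; last 3 first.
  - exact: measurable_LebR_itv.
  - by move=> s _; exact: rearrangement_ge0.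
  - by rewrite lee_fin ltW.
  apply: ge0_le_integral.
  - exact: measurable_LebR_itv.
  - by move=> s _; rewrite mule_ge0 ?rearrangement_ge0 // lee_fin ltW.
  - by apply: emeasurable_funM => //; exact: measurable_cst.
  - by apply: measurable_fun_weight => //; exact: Mfun_rearrangement.
  - move=> s sb; rewrite muleC lee_wpmul2l ?rearrangement_ge0 // lee_fin.
    apply: u_noninc => //; first exact: lb.1.
    by move: sb; rewrite /= in_itv /= => /andP[_ /ltW].
have mub : mu `]0%R, b[ = b%:E by rewrite -itv0_EFin measure_itv0 // lee_fin ltW.
have muE : mu E = a%:E by rewrite fineK.
apply: le_trans (rearrangement_abs_le L_ge0 mf lb mub b_gt0 EI mE muE) _.
rewrite -/k -mulrA EFinM -muleA; apply: lee_wpmul2l; first by rewrite lee_fin ltW.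
rewrite EFinM -muleA lee_pdivlMl //; apply: le_trans Bu _.
by rewrite lee_pdivlMl // muleC.
Qed.

(** By [varrho_integral], a zero value makes [|f|] integrate to 0 over each [E n], and these bounded
    sets exhaust [(0, L)]. *)
Lemma varrho_eq0 f : Mplus L f ->
  varrho L X u v nu f = 0 <-> ae0 L (fun t => f t = 0).
Proof.
move=> mf; split; last by apply: varrho_eq0_of_ae0; exact: mf.1.
move=> rf0; pose E n := itv0 L `&` `]0%R, n%:R[%classic.
have mE n : measurable (E n : set (LebR R)).
  by apply: measurableI; [exact: measurable_itv0|exact: measurable_LebR_itv].
have fE n : finite_measure_subset L (E n).
  split => //; first exact: subIsetl.
  apply: le_lt_trans (measure_itv_lty n%:R); apply: le_measure; rewrite ?inE //.
    exact: measurable_LebR_itv.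
  exact: subIsetr.
have En0 n : ae0 L (fun t => E n t -> f t = 0).
  have [C _ /(_ f mf.1)] := varrho_integral (fE n); rewrite rf0 mule0 => int0.
  have : \int[mu]_(t in E n) `|f t| = 0.
    by apply/eqP; rewrite eq_le int0 integral_ge0.
  have mfE := MfunW (@subIsetl _ _ _ : E n `<=` itv0 L) mf.1.
  move/(@ae_eq_integral_abs _ _ _ mu _ (mE n) _ mfE) => [N [mN N0 hN]].
  exists N; split => // t /= h; apply: hN => /= h'; apply: h => _; exact: h'.
apply: ae0S (ae0_foralln En0) => t tI h.
have [n tn] : exists n : nat, (t < n%:R)%R.
  by exists (Num.truncn t).+1; exact: truncnS_gt.
by apply: (h n); split => //=; rewrite in_itv /= tn andbT; have [] := tI.
Qed.

Lemma weight_primitive_ge t : itv0 L t -> (u t * t)%:E <= weight_primitive u t.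
Proof.
move=> tI; have sub := itv_subset_itv0 tI.
have mt : mu `]0%R, t[ = t%:E by rewrite -itv0_EFin measure_itv0 // ltW // tI.1.
rewrite EFinM -mt -(@integral_cst _ _ _ mu); last exact: measurable_LebR_itv.
apply: ge0_le_integral.
- exact: measurable_LebR_itv.
- by move=> s _; rewrite lee_fin ltW // u_gt0.
- exact: measurable_cst.
- by apply: (MfunW sub); exact: Mfun_weight.
- move=> s st; rewrite lee_fin; apply: u_noninc => //; first exact: sub.
  by move: st; rewrite /= in_itv /= => /andP[_ /ltW].
Qed.

(** Nondegeneracy gives finiteness at one [t0]. Beyond [t0] the weight is at most [u t0], so
    [U(t) <= U(t0) + t u(t0)]. *)
Lemma weight_primitive_lty t : itv0 L t -> weight_primitive u t < +oo.
Proof.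
move=> tI; have [t0 t0I /andP[_ Ut0]] := u_nondeg.
have t_gt0 : (0 < t)%R by have [] := tI.
have mu_ (s : R) : itv0 L s -> measurable_fun (`]0%R, s[%classic : set (LebR R))
    ((fun s => (u s)%:E) : LebR R -> \bar R).
  by move=> /itv_subset_itv0 sub; apply: (MfunW sub); exact: Mfun_weight.
have mt : mu `]0%R, t[ = t%:E by rewrite -itv0_EFin measure_itv0 // lee_fin ltW.
pose w s := ((fun s => (u s)%:E) \_ `]0%R, t0[) s + (u t0)%:E.
have ut0 : 0 <= (u t0)%:E by rewrite lee_fin ltW // u_gt0.
have mp : measurable_fun (`]0%R, t[%classic : set (LebR R))
    (((fun s => (u s)%:E) \_ `]0%R, t0[) : LebR R -> \bar R).
  apply: measurable_funTS.
  by apply/(measurable_restrictT _ (measurable_LebR_itv _)); exact: mu_.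
have p0 s : 0 <= ((fun s => (u s)%:E) \_ `]0%R, t0[) s.
  by apply: erestrict_ge0 => r /(itv_subset_itv0 t0I) /u_gt0 /ltW; rewrite lee_fin.
apply: (@le_lt_trans _ _ (\int[mu]_(s in `]0%R, t[) w s)).
  apply: ge0_le_integral.
  - exact: measurable_LebR_itv.
  - by move=> s /(itv_subset_itv0 tI) /u_gt0 /ltW; rewrite lee_fin.
  - exact: mu_.
  - by apply: emeasurable_funD => //; exact: measurable_cst.
  - move=> s st; have sI := itv_subset_itv0 tI st.
    rewrite /w patchE; case: ifPn => [_|/negP st0]; first by rewrite leeDl.
    rewrite add0e lee_fin; apply: u_noninc => //; rewrite leNgt; apply/negP => h.
    by apply: st0; rewrite inE /= in_itv /= h andbT; have [] := sI.
rewrite (@ge0_integralD _ _ _ mu) //; last exact: measurable_LebR_itv.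
rewrite (@integral_cst _ _ _ mu); last exact: measurable_LebR_itv.
rewrite lte_add_pinfty //; last by rewrite (_ : _ * _ = (u t0 * t)%:E) ?ltry // EFinM -mt.
apply: le_lt_trans Ut0; rewrite -integral_mkcondr.
apply: ge0_subset_integral.
- by apply: measurableI; exact: measurable_LebR_itv.
- exact: measurable_LebR_itv.
- exact: mu_.
- by move=> s /(itv_subset_itv0 t0I) /u_gt0 /ltW; rewrite lee_fin.
- by move=> s [].
Qed.

End weighted_hardy_operator.

(** * Comparison of [xi] with images of indicators *)

Section fundamental_function.
Local Open Scope ereal_scope.
Context (R : realType) (L : \bar R) (X : (R -> \bar R) -> \bar R) (u v nu : R -> R).
Local Notation mu := (@completed_lebesgue_measure R).
Hypothesis L_gt0 : 0 < L.
Hypothesis XP : ri_norm L X.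
Hypothesis u_gt0 : forall t, itv0 L t -> (0 < u t)%R.
Hypothesis u_nondeg : nondegenerate_weight L u.
Hypothesis u_noninc :
  forall s t, itv0 L s -> itv0 L t -> (s <= t)%R -> (u t <= u s)%R.
Hypothesis v_gt0 : forall t, itv0 L t -> (0 < v t)%R.
Hypothesis v_meas : measurable_fun (itv0 L : set (LebR R)) (v : LebR R -> R).
Hypothesis nu_itv0 : forall t, itv0 L t -> itv0 L (nu t).
Hypothesis nu_incr :
  forall s t, itv0 L s -> itv0 L t -> (s < t)%R -> (nu s < nu t)%R.
Implicit Types (f g h F G : R -> \bar R) (s t : R) (E : set R).

Let L_ge0 : 0 <= L := ltW L_gt0.

Local Notation rearr := (rearrangement L).
Local Notation hardy := (hardy u v nu).
Local Notation chi E := (fun t => (\1_E t)%:E).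

Let Mcst1 : Mfun L (cst 1).
Proof. exact: measurable_cst. Qed.

Let Mchi E : measurable (E : set (LebR R)) -> Mfun L (chi E).
Proof. by move=> mE; apply/measurable_EFinP; exact: measurable_indic. Qed.

Let chi_ge0 E t : 0 <= (\1_E t)%:E :> \bar R.
Proof. by rewrite lee_fin. Qed.

Let hardy0 F t : itv0 L t -> (forall s, itv0 L s -> 0 <= F s) -> 0 <= hardy F t.
Proof. exact: hardy_ge0. Qed.

Let hardy1_ge0 t : itv0 L t -> 0 <= hardy (cst 1) t.
Proof. by move=> tI; apply: hardy0 => // s _; rewrite lee_fin. Qed.

Lemma hardy_cst1 t : hardy (cst 1) t = (v t)%:E * weight_primitive u (nu t).
Proof. by congr (_ * _); apply: eq_integral => s _; rewrite mul1e. Qed.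

Lemma xi_fin t : L < +oo -> xi L u v nu t = hardy (cst 1) t.
Proof. by rewrite /xi => ->; rewrite hardy_cst1. Qed.

Lemma xi_infty t : L = +oo -> xi L u v nu t =
  hardy (cst 1) t * (\1_(`]0%R, 1%R[%classic) t)%:E + (v t)%:E * (\1_(`]1%R, +oo[%classic) t)%:E.
Proof. by rewrite /xi => ->; rewrite ltxx hardy_cst1. Qed.

Lemma xi_infty_lt1 t : L = +oo -> (0 < t)%R -> (t < 1)%R ->
  xi L u v nu t = hardy (cst 1) t.
Proof.
move=> Loo t0 t1; rewrite xi_infty // !indicE mem_set /=; last by rewrite in_itv /= t0.
rewrite memNset /= ?mule0 ?mule1 ?adde0 // in_itv /= andbT => /(lt_trans t1).
by rewrite ltxx.
Qed.

Lemma xi_infty_1 : L = +oo -> xi L u v nu 1%R = 0.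
Proof.
move=> Loo; rewrite xi_infty // !indicE memNset /=; last by rewrite in_itv /= ltxx andbF.
by rewrite memNset /= ?mule0 ?adde0 // in_itv /= ltxx.
Qed.

Lemma xi_infty_gt1 t : L = +oo -> (1 < t)%R -> xi L u v nu t = (v t)%:E.
Proof.
move=> Loo t1; rewrite xi_infty // !indicE memNset /=.
  by rewrite mem_set /= ?mule0 ?mule1 ?add0e // in_itv /= t1.
by rewrite in_itv /= => /andP[_ /(lt_trans t1)]; rewrite ltxx.
Qed.

Lemma xi_ge0 t : itv0 L t -> 0 <= xi L u v nu t.
Proof.
move=> tI; have [Lfin|] := ltP L +oo; first by rewrite xi_fin // hardy1_ge0.
rewrite leye_eq => /eqP Loo; rewrite xi_infty // adde_ge0 // mule_ge0 //.
  exact: hardy1_ge0.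
by rewrite lee_fin ltW // v_gt0.
Qed.

Lemma Mplus_xi : Mplus L (xi L u v nu).
Proof.
have [mh _] : Mplus L (hardy (cst 1)).
  by apply: Mplus_hardy => // s _; rewrite lee_fin.
apply: MplusI; last exact: xi_ge0.
have [Loo|] := ltP L +oo.
  by rewrite (_ : xi L u v nu = hardy (cst 1)) //; apply/funext => t; exact: xi_fin.
rewrite leye_eq => /eqP Loo.
rewrite (_ : xi L u v nu = (fun t => hardy (cst 1) t * (\1_(`]0%R, 1%R[%classic) t)%:E +
  (v t)%:E * (\1_(`]1%R, +oo[%classic) t)%:E)); last first.
  by apply/funext => t; exact: xi_infty.
apply: emeasurable_funD; apply: emeasurable_funM.
- exact: mh.
- by apply: Mchi; exact: measurable_LebR_itv.
- exact/measurable_EFinP.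
- by apply: Mchi; exact: measurable_LebR_itv.
Qed.

(** The rearranged indicator is at most 1, which suffices for [L] finite and for [t < 1]. For
    [t > 1] its support bounds the weighted integral by [U(m)]. The point 1 is excluded because [xi]
    vanishes there when [L = +oo]. *)
Lemma hardy_chi_le_xi E : finite_measure_subset L E ->
  exists2 K : R, (0 <= K)%R & forall t, itv0 L t -> t != 1%R ->
    hardy (rearr (chi E)) t <= K%:E * xi L u v nu t.
Proof.
move=> [mE EI Eoo]; have mr := @Mfun_rearrangement R L (chi E).
have r0 s : 0 <= rearr (chi E) s := rearrangement_ge0 _ _ _.
have rle1 s : itv0 L s -> rearr (chi E) s <= 1.
  by move=> [s0 _]; apply: rearrangement_indic_le1; [|exact: Mchi].
have hle1 t : itv0 L t -> hardy (rearr (chi E)) t <= hardy (cst 1) t.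
  by move=> tI; apply: (@hardy_le R L).
have [Lfin|] := ltP L +oo.
  by exists 1%R => // t tI _; rewrite mul1e xi_fin // hle1.
rewrite leye_eq => /eqP Loo.
have E_num : mu E \is a fin_num by rewrite ge0_fin_numE.
(* The added 1 keeps [m] inside [(0, L)] when [E] is null. *)
pose m := (fine (mu E) + 1)%R.
have m_gt0 : (0 < m)%R by rewrite ltr_wpDl ?fine_ge0.
have mI : itv0 L m by rewrite Loo; split; rewrite ?ltry.
have Um_lty : weight_primitive u m < +oo by exact: weight_primitive_lty u_nondeg _ _ mI.
have Um_ge0 : 0 <= weight_primitive u m.
  by apply: integral_ge0 => s /(itv_subset_itv0 mI) /u_gt0 /ltW; rewrite lee_fin.
have Um_num : weight_primitive u m \is a fin_num by rewrite ge0_fin_numE.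
exists (1 + fine (weight_primitive u m))%R; first by rewrite addr_ge0 ?fine_ge0.
move=> t tI; have t_gt0 : (0 < t)%R by have [] := tI.
rewrite neq_lt => /orP[t1|t1].
  rewrite xi_infty_lt1 //; apply: le_trans (hle1 _ tI) _.
  by rewrite lee_pemull ?hardy1_ge0 // lee_fin lerDl fine_ge0.
rewrite xi_infty_gt1 // muleC; apply: lee_wpmul2l.
  by rewrite lee_fin ltW // v_gt0.
apply: (@le_trans _ _ (weight_primitive u m)); last by rewrite EFinD fineK // leeDr.
have ntI := nu_itv0 tI.
have mu_m : measurable_fun (`]0%R, m[%classic : set (LebR R)) ((EFin \o u) : LebR R -> \bar R).
  by apply: (MfunW (itv_subset_itv0 mI)); exact: Mfun_weight.
(* Restricting the weight to []0, m[] covers both orders of [nu t] and [m]. *)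
apply: (@le_trans _ _ (\int[mu]_(s in `]0%R, nu t[) ((EFin \o u) \_ `]0%R, m[) s)).
  apply: ge0_le_integral.
  - exact: measurable_LebR_itv.
  - by move=> s; apply: (@weight_integrand_ge0 R L).
  - by apply: (@measurable_fun_weight R L).
  - apply: measurable_funTS.
    by apply/(measurable_restrictT _ (measurable_LebR_itv _)); exact: mu_m.
  - move=> s st; have sI := itv_subset_itv0 ntI st; have us := u_gt0 sI.
    rewrite patchE; case: ifPn => [_|/negP sm].
      by rewrite /= -[leRHS]mul1e lee_wpmul2r ?rle1 // lee_fin ltW.
    rewrite rearrangement_indic_eq0 ?mul0e //; first exact: Mchi.
    rewrite -(fineK E_num) lee_fin leNgt; apply/negP => sE; apply: sm.
    have [s0 _] := sI; rewrite lte_fin in s0.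
    by rewrite inE /= in_itv /= s0 (lt_trans sE) // ltrDl.
rewrite -integral_mkcondr; apply: ge0_subset_integral.
- by apply: measurableI; exact: measurable_LebR_itv.
- exact: measurable_LebR_itv.
- exact: mu_m.
- by move=> s /(itv_subset_itv0 mI) /u_gt0 /ltW; rewrite lee_fin.
- by move=> s [].
Qed.

Lemma varrho_indic_lty E : ri_space L X (xi L u v nu) -> finite_measure_subset L E ->
  varrho L X u v nu (chi E) < +oo.
Proof.
move=> [_ xiX] fE; have [K K0 hK] := hardy_chi_le_xi fE.
have mxi := Mplus_xi.
have xi0 : ae0 L (fun t => 0 <= K%:E * xi L u v nu t).
  by apply: ae0S mxi.2 => t _ h; rewrite mule_ge0.
have mKxi : Mplus L (fun t => K%:E * xi L u v nu t).
  by split => //; apply: emeasurable_funM; [exact: measurable_cst|exact: mxi.1].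
rewrite varrho_hardy; apply: (@le_lt_trans _ _ (X (fun t => K%:E * xi L u v nu t))).
  apply: (ri_norm_le XP) => //; first exact: Mplus_hardy_rearrangement.
  (* The comparison with [K xi] fails at most at the point 1, a null set. *)
  exists [set 1%R]; split.
  - have -> : [set 1%R] = [set` `[1%R, 1%R]] :> set R by rewrite set_itv1.
    exact: measurable_LebR_itv.
  - exact: lebesgue_measure_set1.
  - move=> t /= h; apply: contrapT => t1; apply: h => tI.
    by apply: hK => //; apply/eqP.
rewrite (ri_normZ XP) //; apply: lte_mul_pinfty => //.
apply: le_lt_trans xiX; apply: (ri_norm_le XP) => //.
  by apply: MplusI; [apply: Mfun_abs; exact: mxi.1|move=> t _].
by apply: aeW => t tI; exact: lee_abs.
Qed.

(** For finite [L], [E = (0, L)] gives equality. Otherwise [E = ]0, b[] with [b = nu 1]: below 1 the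
    indicator is 1 on the whole range of integration, and above 1 the integral is at least
    [U(b) >= u(b) b], whence the constant. *)
Lemma xi_le_hardy_chi : exists2 E, finite_measure_subset L E &
  exists2 K : R, (0 <= K)%R &
    forall t, itv0 L t -> xi L u v nu t <= K%:E * hardy (chi E) t.
Proof.
have [Lfin|] := ltP L +oo.
  exists (itv0 L).
    by split => //; [exact: measurable_itv0|rewrite measure_itv0].
  exists 1%R => // t tI; rewrite mul1e xi_fin // le_eqVlt; apply/orP; left; apply/eqP.
  by apply: (@hardy_eq R L) => // s sI; rewrite indicE mem_set.
rewrite leye_eq => /eqP Loo.
have I1 : itv0 L 1%R by rewrite Loo; split; rewrite ?lte_fin ?ltry.
pose b := nu 1%R; have bI : itv0 L b := nu_itv0 I1.
have b_gt0 : (0 < b)%R by have [] := bI.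
have ub_gt0 := u_gt0 bI.
have mE : measurable (`]0%R, b[%classic : set (LebR R)) by exact: measurable_LebR_itv.
exists `]0%R, b[%classic.
  by split => //; [exact: itv_subset_itv0|exact: measure_itv_lty].
have K_ge0 : (0 <= (u b * b)^-1)%R by rewrite invr_ge0 ltW // mulr_gt0.
exists (1 + (u b * b)^-1)%R; first by rewrite addr_ge0.
move=> t tI; have t_gt0 : (0 < t)%R by have [] := tI.
have hc0 : 0 <= hardy (chi `]0%R, b[%classic) t by exact: hardy0.
have [t1|t1|t1] := ltgtP t 1%R; last first.
- by rewrite {1}t1 xi_infty_1 // mule_ge0 // lee_fin addr_ge0.
- rewrite xi_infty_gt1 // muleCA -[leLHS]mule1; apply: lee_wpmul2l.
    by rewrite lee_fin ltW // v_gt0.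
  have Ub : (u b * b)%:E <=
      \int[mu]_(s in `]0%R, nu t[) ((\1_(`]0%R, b[%classic) s)%:E * (u s)%:E).
    apply: le_trans (weight_primitive_ge u_gt0 u_noninc bI) _.
    have -> : weight_primitive u b =
        \int[mu]_(s in `]0%R, b[) ((\1_(`]0%R, b[%classic) s)%:E * (u s)%:E).
      by apply: eq_integral => s; rewrite indicE => -> /=; rewrite mul1e.
    apply: (@weight_integral_le R L) => //; [exact: nu_itv0| |exact: Mchi].
    by apply: ltW; exact: nu_incr.
  apply: le_trans (lee_wpmul2l _ Ub); last by rewrite lee_fin addr_ge0.
  rewrite -EFinM lee_fin mulrDl mul1r mulVf ?lerDr ?mulr_ge0 ?(ltW b_gt0) ?(ltW ub_gt0) //.
  by rewrite gt_eqF // mulr_gt0.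
- rewrite xi_infty_lt1 //.
  have -> : hardy (cst 1) t = hardy (chi `]0%R, b[%classic) t.
    congr (_ * _); apply: eq_integral => s; rewrite inE /= in_itv /= => /andP[s0 st].
    rewrite indicE mem_set //= in_itv /= s0 /=; apply: (lt_trans st).
    exact: nu_incr.
  by rewrite lee_pemull // lee_fin lerDl.
Qed.

(** * Boundedness of the operator and optimality *)

Lemma bounded_operator_pos T (Z Y : (R -> \bar R) -> \bar R) : ri_norm L Z ->
  bounded_operator L T Z Y -> exists2 C : R, (0 < C)%R &
    forall f, Mfun L f -> abs_norm Y (T f) <= C%:E * abs_norm Z f.
Proof.
move=> ZP [C hC]; exists (Num.max C 1)%R; first by rewrite lt_max ltr01 orbT.
move=> f mf; apply: le_trans (hC f mf) _; apply: lee_wpmul2r.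
  exact: (abs_norm_ge0 ZP).
by rewrite lee_fin le_max lexx.
Qed.

(** The image is known to be nonnegative on [(0, L)] only, so the absolute value is removed through
    the norm and not by equality of functions. *)
Lemma abs_norm_Rop g : Mfun L g ->
  abs_norm X (Rop u v nu g) = X (hardy (fun t => `|g t|)).
Proof.
move=> mg; have mh : Mplus L (hardy (fun t => `|g t|)).
  by apply: Mplus_hardy => //; exact: Mfun_abs.
apply: (ri_norm_eq_in XP) => //.
  by apply: MplusI; [apply: Mfun_abs; exact: mh.1|move=> t _].
by move=> t tI; rewrite gee0_abs // Rop_hardy; exact: hardy0.
Qed.

(** By (P4) the indicator from [xi_le_hardy_chi] has finite norm in [Z], so its image, which
    dominates a multiple of [xi], has finite norm in [X]. *)
Lemma xi_ri_space (Z : (R -> \bar R) -> \bar R) : ri_norm L Z ->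
  bounded_operator L (Rop u v nu) Z X -> ri_space L X (xi L u v nu).
Proof.
move=> ZP /(bounded_operator_pos ZP) [C C0 hC]; have mxi := Mplus_xi.
split; first exact: mxi.1.
have [E fE [K K0 hK]] := xi_le_hardy_chi; have [mE EI Eoo] := fE.
have chiE : (fun t => `|(\1_E t)%:E|) = chi E :> (R -> \bar R).
  by apply/funext => t; rewrite gee0_abs.
have mh : Mplus L (hardy (chi E)) by apply: Mplus_hardy => //; exact: Mchi.
apply: (@le_lt_trans _ _ (K%:E * X (hardy (chi E)))).
  rewrite -(ri_normZ XP) //; apply: (ri_norm_le_in XP).
  - by apply: MplusI; [apply: Mfun_abs; exact: mxi.1|move=> t _].
  - apply: MplusI => [|t tI]; first by apply: emeasurable_funM; [exact: measurable_cst|exact: mh.1].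
    by rewrite mule_ge0 // hardy0.
  - by move=> t tI; rewrite gee0_abs ?hK ?xi_ge0.
apply: lte_mul_pinfty => //.
have := hC (chi E) (Mchi mE); rewrite abs_norm_Rop ?chiE; last exact: Mchi.
move=> /le_lt_trans; apply; apply: lte_mul_pinfty => //; first by rewrite lee_fin ltW.
by rewrite /abs_norm chiE; exact: (ri_norm_indic ZP).
Qed.

Lemma ri_norm_varrho : ri_space L X (xi L u v nu) -> ri_norm L (varrho L X u v nu).
Proof.
move=> xiX; split.
- by move=> f _; exact: varrho_ge0.
- by move=> f; exact: varrho_eq0.
- by move=> a f; exact: varrhoZ.
- by move=> f g; exact: varrhoD.
- by move=> f g; exact: varrho_le.
- by move=> f_ f; exact: varrho_cvg.
- by move=> E; exact: varrho_indic_lty.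
- move=> E fE; have [C C0 hC] := varrho_integral L_gt0 XP u_gt0 u_nondeg
    u_noninc v_gt0 v_meas nu_itv0 nu_incr fE.
  exists C => // f mf; have [mE EI _] := fE; apply: le_trans (hC f mf.1).
  apply: le_trans (lee_abs _) _.
  by apply: le_abse_integral => //; apply: (MfunW EI); exact: mf.1.
- by move=> f g mf mg /equimeasurable_rearrangement fg; rewrite !varrho_hardy fg.
Qed.

Lemma bounded_Rop_varrho : bounded_operator L (Rop u v nu) (varrho L X u v nu) X.
Proof.
exists 1%R => f mf; rewrite mul1e abs_norm_Rop // /abs_norm varrho_abs varrho_hardy.
apply: (ri_norm_le_in XP).
- by apply: Mplus_hardy => //; exact: Mfun_abs.
- exact: Mplus_hardy_rearrangement.
- move=> t tI; apply: lee_wpmul2l; first by rewrite lee_fin ltW // v_gt0.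
  by apply: (@hardy_littlewood_weight R L) => //; exact: nu_itv0.
Qed.

(* [f] and its rearrangement have the same norm in [Z], and the operator at
   the rearrangement of [f] has norm [varrho f] in [X]. *)
Lemma embedded_varrho (Z : (R -> \bar R) -> \bar R) : ri_norm L Z ->
  bounded_operator L (Rop u v nu) Z X -> embedded L Z (varrho L X u v nu).
Proof.
move=> ZP /(bounded_operator_pos ZP) [C C0 hC]; exists C => // f mf.
have mr := @Mfun_rearrangement R L f.
have rE : (fun t => `|rearr f t|) = rearr f.
  by apply/funext => t; rewrite gee0_abs ?rearrangement_ge0.
have := hC _ mr; rewrite abs_norm_Rop // rE -varrho_hardy /abs_norm varrho_abs rE.
suff -> : Z (rearr f) = Z (fun t => `|f t|) by [].
apply: (ri_norm_equim ZP).
- by apply: MplusI => // t _; exact: rearrangement_ge0.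
- by apply: MplusI; [exact: Mfun_abs|move=> t _].
- by rewrite -(rearrangement_abs L f); apply: equimeasurable_rearrangementl => //; exact: Mfun_abs.
Qed.

End fundamental_function.
Theorem proposition3p2 (R : realType) (L : \bar R)
    (X : (R -> \bar R) -> \bar R) (u v nu : R -> R)
    (hL : (0 < L)%E)
    (hX : ri_norm L X)
    (u_gt0 : forall t, itv0 L t -> 0 < u t)
    (u_nondeg : nondegenerate_weight L u)
    (u_noninc : forall s t, itv0 L s -> itv0 L t -> s <= t -> u t <= u s)
    (u_left : forall l : R, L = l%:E -> 0 < lim (u t @[t --> l^'-]))
    (v_gt0 : forall t, itv0 L t -> 0 < v t)
    (v_meas : measurable_fun (itv0 L : set (LebR R)) (v : LebR R -> R))
    (nu_bij : set_bij (itv0 L) (itv0 L) nu)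
    (nu_incr : forall s t, itv0 L s -> itv0 L t -> s < t -> nu s < nu t) :
  [/\ ri_norm L (varrho L X u v nu) <-> ri_space L X (xi L u v nu),
      ri_space L X (xi L u v nu) ->
        optimal_domain L (Rop u v nu) X (varrho L X u v nu) &
      ~ ri_space L X (xi L u v nu) ->
        ~ exists Z : (R -> \bar R) -> \bar R,
            ri_norm L Z /\ bounded_operator L (Rop u v nu) Z X].
Proof.
have [nu_itv0 _ _] := nu_bij.
have bounded : bounded_operator L (Rop u v nu) (varrho L X u v nu) X.
  exact: bounded_Rop_varrho.
have xiX (Z : (R -> \bar R) -> \bar R) : ri_norm L Z ->
    bounded_operator L (Rop u v nu) Z X -> ri_space L X (xi L u v nu).
  exact: xi_ri_space.
have normP : ri_space L X (xi L u v nu) -> ri_norm L (varrho L X u v nu).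
  exact: ri_norm_varrho.
split.
(* For necessity, [varrho] itself takes the role of [Z]. *)
- by split => [rP|]; [exact: xiX rP bounded|exact: normP].
- move=> xi_in; split; [exact: normP|exact: bounded|].
  by move=> Z ZP; exact: embedded_varrho.
- by move=> xi_notin [Z [ZP Zb]]; apply: xi_notin; exact: xiX ZP Zb.
Qed.
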